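(* Let $r\in[0,\infty)$, let $p\in(0,\infty)$, let $u\in\mathbb{S}^{n-1}$, let $H=\{x\in\mathbb{R}^n:\langle x,u\rangle=0\}$, and let $K\subset\mathbb{R}^n$ be a compact set with non-empty interior. Let $f:\mathbb{R}\to\mathbb{R}_{\geq0}$, $f(t)=\mathrm{vol}_{n-1}\bigl(K\cap(tu+H)\bigr)$, and assume $f$ is $p$-concave. Assume that $\mathrm{g}_r=0$, where $\mathrm{g}_r$ is the $r$-powered centroid of $K$ in direction $u$ defined in the context. Let $K^-=K\cap\{x\in\mathbb{R}^n:\langle x,u\rangle\leq 0\}$. Then, if $r\geq1$, \[\frac{\mathrm{vol}(K^-)}{\mathrm{vol}(K)}\geq\left(\frac{p+1}{2p+r}\right)^{(p+1)/p},\] whereas if $0\leq r\leq 1$, \[\frac{\mathrm{vol}(K^-)}{\mathrm{vol}(K)}\geq\left(\frac{p+r}{2p+r}\right)^{(p+1)/p}.\]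
   Context: $\mathrm{vol}_k$ denotes $k$-dimensional Lebesgue measure, $\mathrm{vol}=\mathrm{vol}_n$. A function $\varphi:\mathbb{R}^m\to\mathbb{R}_{\geq0}$ is $p$-concave ($p>0$) if $\varphi((1-\lambda)x+\lambda y)\geq((1-\lambda)\varphi(x)^p+\lambda\varphi(y)^p)^{1/p}$ for all $x,y$ with $\varphi(x)\varphi(y)>0$ and all $\lambda\in(0,1)$; equivalently $\varphi^p$ is concave on its support. Under the hypotheses, $\{t:f(t)>0\}$ is an interval $(a,b)$ (up to endpoints), and $[a,b]$ denotes the support of $f$. For $r>0$ the $r$-powered centroid (in direction $u$) is $\mathrm{g}_r=\frac{\int_a^b t f(t)^r\,dt}{\int_a^b f(t)^r\,dt}$; for $r=0$, $\mathrm{g}_0=\frac{a+b}{2}$ (the midpoint of $K$ in direction $u$, corresponding to $f^0$ being the indicator of $[a,b]$). The hypothesis ''$\mathrm{g}_r=0$'' means the point $\mathrm{g}_r\cdot u$ is the origin. *)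

(* Defs.v *)
From HB Require Import structures.
From mathcomp Require Import all_boot all_order all_algebra.
From mathcomp Require Import all_classical all_reals all_analysis.
Set Implicit Arguments. Unset Strict Implicit. Unset Printing Implicit Defensive.
Import Order.TTheory GRing.Theory Num.Theory.
Import numFieldNormedType.Exports.
Local Open Scope classical_set_scope.
Local Open Scope ring_scope.

Section Defs.
Variable R : realType.

Definition dotv (n : nat) (x y : 'rV[R]_n) : R := \sum_(i < n) x 0 i * y 0 i.

(* n-dimensional Lebesgue volume, defined as the iterated (Tonelli) integral
   of the indicator of A with respect to one-dimensional Lebesgue measure.
   For Borel sets (in particular compact sets) this is the n-dimensional
   Lebesgue measure. *)
Fixpoint lvol (n : nat) : set 'rV[R]_n -> \bar R :=
  match n with
  | 0 => fun A => (\1_A (0 : 'rV[R]_0))%:E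
  | m.+1 => fun A =>
      (\int[@lebesgue_measure R]_(t in [set: R])
          lvol [set y : 'rV[R]_m | A (row_mx (\row_(i < 1) t) y)])%E
  end.

(* vol_{n}( K ∩ (t u + H) ), where H = u^⊥ in R^{n+1} is parametrized
   isometrically by y ↦ y *m Q, Q : 'M_(n, n.+1) having orthonormal rows
   orthogonal to u. *)
Definition section_vol (n : nat) (K : set 'rV[R]_n.+1) (u : 'rV[R]_n.+1)
  (Q : 'M[R]_(n, n.+1)) (t : R) : R :=
  fine (lvol [set y : 'rV[R]_n | K (t *: u + y *m Q)]).

Definition p_concave (p : R) (f : R -> R) : Prop :=
  (forall t, 0 <= f t) /\
  forall x y (l : R), 0 < f x * f y -> 0 < l < 1 ->
    powR ((1 - l) * powR (f x) p + l * powR (f y) p) (p^-1)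
      <= f ((1 - l) * x + l * y).

Definition powered_centroid (r : R) (f : R -> R) : R :=
  if r == 0 then
    (inf [set t | 0 < f t] + sup [set t | 0 < f t]) / 2
  else
    Rintegral (@lebesgue_measure R) [set: R] (fun t => t * powR (f t) r) /
    Rintegral (@lebesgue_measure R) [set: R] (fun t => powR (f t) r).

End Defs.

(* Main.v *)
Require Import Defs.
From HB Require Import structures.
From mathcomp Require Import all_boot all_order all_algebra.
From mathcomp Require Import all_classical all_reals all_analysis.
From mathcomp Require Import measurable_realfun ring lra.
Set Implicit Arguments. Unset Strict Implicit. Unset Printing Implicit Defensive.
Import Order.TTheory GRing.Theory Num.Theory.
Import numFieldNormedType.Exports.
Local Open Scope classical_set_scope.
Local Open Scope ring_scope.

(** Let [V] be the distribution function of the section function [f],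
    normalized by [V b = 1], and [phi = V ^ (p / (p + 1))].  Since [f] is
    p-concave, [f ^ (p + 1) / V] is nonincreasing, hence [phi] is concave and,
    by its support line at the centroid [0], [phi 0] is at least the mean of
    [phi] with respect to the weight [f ^ r].  Expressed in the variable [phi],
    this weight is a Beta(al, be) density times a nondecreasing factor, with
    [(al, be) = (r / p + 1, 1)] when [r <= 1] and
    [(al, be) = (1 / p + 1, (r - 1) / p + 1)] when [r >= 1]; its mean is
    therefore at least [al / (al + be)], the base of the claimed bound.

    To identify [V 0] with the ratio of volumes, the iterated integral [lvol]
    must be invariant under the rotation taking the first axis to [u].  For
    Lipschitz functions with bounded support this is the uniqueness of Haar
    measure: by Fubini's theorem, [(int g) (int h o M) = (int h) (int g o M)],
    and one takes a radial [h].  Compact sets follow by dominated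
    convergence. *)

(** * Calculus for p-concave densities *)

Section calculus.
Context {R : realType}.
Implicit Types (F dF G W f : R -> R) (a b p q r s t x y : R).

(** The exponent [p / (p + 1)] is the one that makes [phi] affine when [f ^ p] is affine and
    vanishes at the left end of the support; in that case every estimate for [r <= 1] is an
    equality. For [r > 1] the power [r - 1] of the derivative of [phi] is nonincreasing, hence
    unusable as the monotone factor; [f ^ (r - 1)] is compared with a power of [1 - phi] instead,
    whence the second Beta parameter. Since [f] may jump at the ends of its support, derivatives are
    taken only inside, and the ends are reached through the continuous primitives [W], [Z], [P] of
    [f], [f ^ r], [t * f ^ r]. The centroid condition reads [P a = P b], and an inequality between
    means becomes the monotonicity of one combination of primitives; no change of variable is made.
    In several dimensions, nonnegative bounded Lipschitz functions with bounded support are stable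
    under sections, partial integration and invertible linear substitutions, so integrability is
    automatic and Fubini's theorem is applied only on the plane. *)

Lemma MVT_closed F dF x y : x < y ->
  (forall z, x <= z -> z <= y -> is_derive z 1 F (dF z)) ->
  exists c, [/\ x < c, c < y & F y - F x = dF c * (y - x)].
Proof.
move=> xy hF.
have [||c] := @MVT R F dF x y xy.
- by move=> z; rewrite in_itv/= => /andP[xz zy]; apply: hF; exact: ltW.
- apply: derivable_within_continuous => z; rewrite in_itv/= => /andP[xz zy].
  by case: (hF z xz zy).
by rewrite in_itv/= => /andP[xc cy] h; exists c.
Qed.

Lemma is_derive_ndecr F dF a b :
  (forall z, a < z -> z < b -> is_derive z 1 F (dF z)) ->
  (forall z, a < z -> z < b -> 0 <= dF z) ->
  forall x y, a < x -> x <= y -> y < b -> F x <= F y.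
Proof.
move=> hF dF0 x y ax; rewrite le_eqVlt => /predU1P[->//|xy] yb.
have [|c [xc cy h]] := @MVT_closed F dF x y xy.
  by move=> z xz zy; apply: hF; [exact: lt_le_trans xz|exact: le_lt_trans yb].
rewrite -subr_ge0 h mulr_ge0 ?subr_ge0 ?(ltW xy)//.
by apply: dF0; [exact: lt_trans xc|exact: lt_trans yb].
Qed.

Lemma within_cvg_left W a b : a < b -> {within `[a, b], continuous W} ->
  W x @[x --> a^'+] --> W a.
Proof. by move=> ab /(continuous_within_itvP _ ab)[]. Qed.

Lemma within_cvg_right W a b : a < b -> {within `[a, b], continuous W} ->
  W x @[x --> b^'-] --> W b.
Proof. by move=> ab /(continuous_within_itvP _ ab)[]. Qed.

Lemma at_right_ge F a b l M : a < b -> F x @[x --> a^'+] --> l ->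
  (forall x, a < x -> x < b -> M <= F x) -> M <= l.
Proof.
move=> ab cF h; apply: (cvgr_to_ge cF).
near=> x; apply: h; near: x; [exact: nbhs_right_gt|exact: nbhs_right_lt].
Unshelve. all: by end_near. Qed.

Lemma at_left_ge F a b l M : a < b -> F x @[x --> b^'-] --> l ->
  (forall x, a < x -> x < b -> M <= F x) -> M <= l.
Proof.
move=> ab cF h; apply: (cvgr_to_ge cF).
near=> x; apply: h; near: x; [exact: nbhs_left_gt|exact: nbhs_left_lt].
Unshelve. all: by end_near. Qed.

(* Concavity on the open interval, as the chord inequality multiplied by
   [y - x]. *)
Definition concave_oo G a b := forall x y z, a < x -> x < z -> z < y -> y < b ->
  G x * (y - z) + G y * (z - x) <= G z * (y - x).

Lemma at_right_le F a b l M : a < b -> F x @[x --> a^'+] --> l ->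
  (forall x, a < x -> x < b -> F x <= M) -> l <= M.
Proof.
move=> ab cF h; rewrite -lerN2; apply: (@at_right_ge (\- F) a b) => //.
  exact: cvgN.
by move=> x ax xb; rewrite lerN2 h.
Qed.

Lemma at_left_le F a b l M : a < b -> F x @[x --> b^'-] --> l ->
  (forall x, a < x -> x < b -> F x <= M) -> l <= M.
Proof.
move=> ab cF h; rewrite -lerN2; apply: (@at_left_ge (\- F) a b) => //.
  exact: cvgN.
by move=> x ax xb; rewrite lerN2 h.
Qed.

Lemma is_derive_affine_powR (c m x0 x e : R) : 0 < c + m * (x - x0) ->
  is_derive x 1 (fun x => (c + m * (x - x0)) `^ e)
    (e * (c + m * (x - x0)) `^ (e - 1) * m).
Proof.
move=> h.
have h1 : is_derive x 1 (fun x => c + m * (x - x0)) m.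
  apply: is_derive_eq; by rewrite add0r mul1r subr0 /GRing.scale/= mulr1.
have := @is_derive1_comp R (@powR R ^~ e) (fun x => c + m * (x - x0)) x _ _ (is_derive1_powR e h) h1.
by [].
Qed.

(** * Concavity of a power of the primitive *)

Section concave_power.
Variables (a b p : R) (f W : R -> R).
Hypothesis p0 : 0 < p.
Hypothesis ab : a < b.
Hypothesis f_gt0 : forall x, a < x -> x < b -> 0 < f x.
Hypothesis fconc : concave_oo (fun x => f x `^ p) a b.
Hypothesis W' : forall x, a < x -> x < b -> is_derive x 1 W (f x).
Hypothesis cW : {within `[a, b], continuous W}.
Hypothesis Wa : W a = 0.

Let Wnd x y : a < x -> x <= y -> y < b -> W x <= W y.
Proof.
by apply: is_derive_ndecr W' _ x y => x ax xb; exact/ltW/f_gt0.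
Qed.

Lemma prim_ge0 x : a < x -> x < b -> 0 <= W x.
Proof.
move=> ax xb; rewrite -Wa; apply: (at_right_le ax (within_cvg_left ab cW)).
by move=> y ay yx; apply: Wnd => //; exact: ltW.
Qed.

Lemma prim_gt0 x : a < x -> x < b -> 0 < W x.
Proof.
move=> ax xb; have [ay yx] := midf_lt ax; set y := (a + x) / 2 in ay yx.
have yb := lt_trans yx xb.
have [|c [yc cx h]] := @MVT_closed W f y x yx.
  by move=> z yz zx; apply: W'; [exact: lt_le_trans yz|exact: le_lt_trans xb].
apply: le_lt_trans (prim_ge0 ay yb) _; rewrite -subr_gt0 h mulr_gt0 ?subr_gt0//.
by apply: f_gt0; [exact: lt_trans yc|exact: lt_trans xb].
Qed.

(* Where [f] increases, [f] is compared with the [1/p]-th power of the affine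
   chord of [f ^ p] through [s] and [t]: below it on the left of [s],
   above it between [s] and [t]. *)
Lemma powR_div_prim_nincr s t : a < s -> s < t -> t < b ->
  f t `^ (p + 1) * W s <= f s `^ (p + 1) * W t.
Proof.
move=> as_ st tb.
have sb := lt_trans st tb; have at_ := lt_trans as_ st.
have p1 : 0 < p + 1 by rewrite addr_gt0.
have fs := f_gt0 as_ sb; have ft := f_gt0 at_ tb.
have [fts|fst] := leP (f t) (f s).
  apply: ler_pM; rewrite ?powR_ge0 ?prim_ge0//; last exact: Wnd (ltW st) _.
  by apply: ge0_ler_powR; rewrite ?nnegrE ?(ltW fs) ?(ltW ft) ?(ltW p1)//; exact: ltW.
pose Gs := f s `^ p; pose Gt := f t `^ p.
pose m := (Gt - Gs) / (t - s).
have Gst : Gs < Gt by apply: gt0_ltr_powR; rewrite ?nnegrE ?ltW.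
have m0 : 0 < m by rewrite divr_gt0 ?subr_gt0.
pose l x := Gs + m * (x - s).
have ls : l s = Gs by rewrite /l subrr mulr0 addr0.
have lt_ : l t = Gt by rewrite /l /m divfK ?subrKC// gt_eqF ?subr_gt0.
have ts : 0 < t - s by rewrite subr_gt0.
have mE : m * (t - s) = Gt - Gs by rewrite /m divfK ?gt_eqF.
have l_ge x : a < x -> x <= s -> f x `^ p <= l x.
  move=> ax; rewrite le_eqVlt => /predU1P[->|xs]; first by rewrite ls.
  have := fconc ax xs st tb.
  rewrite -/Gs -/Gt => h.
  rewrite -(ler_pM2r ts) /l; nra.
have l_le x : s < x -> x < t -> l x <= f x `^ p.
  move=> sx xt; have := fconc as_ sx xt tb.
  rewrite -/Gs -/Gt => h.
  rewrite -(ler_pM2r ts) /l; nra.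
have l_gt0 x : a < x -> 0 < l x.
  move=> ax; have [xs|sx] := leP x s.
    apply: lt_le_trans (l_ge _ ax xs); rewrite powR_gt0// f_gt0//.
    exact: le_lt_trans sb.
  rewrite /l addr_gt0//; first exact: powR_gt0.
  by apply: mulr_gt0 => //; rewrite subr_gt0.
pose e := (p + 1) / p.
have e0 : 0 < e by rewrite divr_gt0// addr_gt0.
have e1 : e - 1 = p^-1 by rewrite /e; field; rewrite gt_eqF.
(* [E] is the primitive of [l ^ (1 / p)] that vanishes with [l]. At [s] and [t] it is the same
   multiple of [f ^ (p + 1)], so the claim becomes [E t * W s <= E s * W t], which follows from
   [Ws], [Wt] and [E s <= E t]. *)
pose E x := (e * m)^-1 * l x `^ e.
have em0 : 0 < e * m by rewrite mulr_gt0.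
have E' x : a < x -> is_derive x 1 E (l x `^ p^-1).
  move=> ax; have := @is_derive_affine_powR Gs m s x e (l_gt0 _ ax).
  move=> /(is_deriveZ (e * m)^-1) h; apply: is_derive_eq.
  rewrite e1 /GRing.scale/= -/(l x).
  set u := l x `^ _.
  have [en mn] : e != 0 /\ m != 0 by rewrite !gt_eqF.
  by clearbody u e m; field; rewrite en mn.
have fE x : a < x -> x < b -> f x = (f x `^ p) `^ p^-1.
  by move=> ax xb; rewrite -powRrM mulfV ?gt_eqF// powRr1// ltW// f_gt0.
(* [W - E] is nonincreasing on the left of [s]. The term [E x] is dropped by its sign before [x]
   tends to [a], where [W] vanishes. *)
have Ws : W s <= E s.
  have h x : a < x -> x < s -> W s - E s <= W x.
    move=> ax xs; apply: (@le_trans _ _ (W x - E x)); last first.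
      by rewrite gerBl mulr_ge0 ?powR_ge0// invr_ge0 ltW.
    have [|c [xc cs h]] := @MVT_closed (W \- E) (fun x => f x - l x `^ p^-1) x s xs.
      move=> z xz zs; have az := lt_le_trans ax xz.
      by apply: is_deriveB; [apply: W' => //; exact: le_lt_trans sb|exact: E'].
    have ac := lt_trans ax xc.
    rewrite -subr_le0; have -> : W s - E s - (W x - E x) = (W \- E) s - (W \- E) x by [].
    rewrite h; apply: mulr_le0_ge0; last by rewrite subr_ge0 ltW.
    rewrite subr_le0 fE//; last exact: lt_trans sb.
    apply: ge0_ler_powR; rewrite ?nnegrE ?invr_ge0 ?powR_ge0 ?(ltW p0) ?(ltW (l_gt0 _ ac))//.
    by apply: l_ge => //; exact: ltW.
  rewrite -subr_le0 -Wa.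
  by apply: (at_right_ge as_ (within_cvg_left ab cW)) => x ax xs; exact: h.
have Wt : E t - E s <= W t - W s.
  have [|c [sc ct h]] := @MVT_closed (W \- E) (fun x => f x - l x `^ p^-1) s t st.
    move=> z sz zt; have az := lt_le_trans as_ sz.
    by apply: is_deriveB; [apply: W' => //; exact: le_lt_trans tb|exact: E'].
  have ac := lt_trans as_ sc.
  suff : 0 <= (W \- E) t - (W \- E) s by rewrite /=; lra.
  rewrite h; apply: mulr_ge0; last by rewrite ltW.
  rewrite subr_ge0 [leRHS]fE//; last exact: lt_trans tb.
  apply: ge0_ler_powR; rewrite ?nnegrE ?invr_ge0 ?powR_ge0 ?(ltW p0) ?(ltW (l_gt0 _ ac))//.
  exact: l_le.
have pe : p * e = p + 1 by rewrite /e mulrCA mulfV ?mulr1 ?gt_eqF.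
have Es : E s = (e * m)^-1 * f s `^ (p + 1).
  by rewrite /E ls /Gs -powRrM pe.
have Et : E t = (e * m)^-1 * f t `^ (p + 1).
  by rewrite /E lt_ /Gt -powRrM pe.
have Est : E s <= E t.
  rewrite Es Et ler_pM2l ?invr_gt0//.
  by apply: ge0_ler_powR; rewrite ?nnegrE ?(ltW fs) ?(ltW ft) ?(ltW p1)//; exact: ltW.
have : E t * W s <= E s * W t.
  have := prim_ge0 as_ sb.
  have : 0 <= E s by rewrite Es mulr_ge0 ?invr_ge0 ?powR_ge0 ?ltW.
  nra.
by rewrite Es Et -![_ * _ * W _]mulrA ler_pM2l ?invr_gt0.
Qed.

Let q := p / (p + 1).

Let p1_gt0 : 0 < p + 1. Proof. by rewrite ltr_wpDl ?ltW. Qed.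

Let q0 : 0 < q. Proof. by rewrite divr_gt0. Qed.

Lemma is_derive_powR_prim e x : a < x -> x < b ->
  is_derive x 1 (fun x => W x `^ e) (e * W x `^ (e - 1) * f x).
Proof.
move=> ax xb.
exact: (is_derive1_comp (is_derive1_powR e (prim_gt0 ax xb)) (W' ax xb)).
Qed.

(** Since [q - 1 = - (p + 1)^-1], the derivative of [W ^ q] is [q] times the [(p + 1)]-th root of
    [f ^ (p + 1) / W], whose monotonicity is already known. *)
Lemma derive_powR_prim_nincr s t : a < s -> s <= t -> t < b ->
  q * W t `^ (q - 1) * f t <= q * W s `^ (q - 1) * f s.
Proof.
move=> as_; rewrite le_eqVlt => /predU1P[->//|st] tb.
have sb := lt_trans st tb; have at_ := lt_trans as_ st.
have e0 : 0 < (p + 1)^-1 by rewrite invr_gt0.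
have q1 : q - 1 = - (p + 1)^-1 by rewrite /q; field; rewrite gt_eqF.
have fK x : a < x -> x < b -> (f x `^ (p + 1)) `^ (p + 1)^-1 = f x.
  by move=> ax xb; rewrite -powRrM mulfV ?gt_eqF// powRr1// ltW// f_gt0.
rewrite -![q * _ * _]mulrA ler_pM2l// q1 !powRN ![_^-1 * f _]mulrC.
rewrite ler_pdivrMr ?powR_gt0 ?prim_gt0// mulrAC.
rewrite ler_pdivlMr ?powR_gt0 ?prim_gt0//.
have fKM x y : a < x -> x < b -> a < y -> y < b ->
    f x * W y `^ (p + 1)^-1 = (f x `^ (p + 1) * W y) `^ (p + 1)^-1.
  by move=> ax xb ay yb; rewrite powRM ?powR_ge0 ?prim_ge0// fK.
rewrite (fKM t s)// (fKM s t)//.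
have := powR_div_prim_nincr as_ st tb.
by apply: ge0_ler_powR; rewrite ?nnegrE ?(ltW e0) ?mulr_ge0 ?powR_ge0 ?prim_ge0.
Qed.

Lemma powR_prim_conc : concave_oo (fun x => W x `^ q) a b.
Proof.
move=> x y z ax xz zy yb.
have az := lt_trans ax xz; have zb := lt_trans zy yb.
pose d x := q * W x `^ (q - 1) * f x.
have [|c [xc cz h1]] := @MVT_closed (fun x => W x `^ q) d x z xz.
  by move=> u xu uz; apply: is_derive_powR_prim;
    [exact: lt_le_trans xu|exact: le_lt_trans zb].
have [|c' [zc' c'y h2]] := @MVT_closed (fun x => W x `^ q) d z y zy.
  by move=> u xu uz; apply: is_derive_powR_prim;
    [exact: lt_le_trans xu|exact: le_lt_trans yb].
have : d c' <= d c.
  apply: derive_powR_prim_nincr; [exact: lt_trans xc| |exact: lt_trans yb].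
  exact/ltW/(lt_trans cz).
have : 0 < z - x by rewrite subr_gt0.
have : 0 < y - z by rewrite subr_gt0.
have -> : W x `^ q = W z `^ q - d c * (z - x) by lra.
have -> : W y `^ q = W z `^ q + d c' * (y - z) by lra.
move=> zx yz dcc; rewrite -subr_ge0.
rewrite [leRHS](_ : _ = (d c - d c') * ((z - x) * (y - z))); last by ring.
by rewrite mulr_ge0 ?subr_ge0// ltW// mulr_gt0.
Qed.

Lemma powR_prim_support u x : a < u -> u < b -> a < x -> x < b ->
  W x `^ q <= W u `^ q + q * W u `^ (q - 1) * f u * (x - u).
Proof.
move=> au ub ax xb; pose d x := q * W x `^ (q - 1) * f x.
case: (ltgtP x u) => [xu|ux|->]; last by rewrite subrr mulr0 addr0.
  have [|c [xc cu h]] := @MVT_closed (fun x => W x `^ q) d x u xu.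
    by move=> z xz zu; apply: is_derive_powR_prim;
      [exact: lt_le_trans xz|exact: le_lt_trans ub].
  have : d u <= d c.
    by apply: derive_powR_prim_nincr => //; [exact: lt_trans xc|exact: ltW].
  rewrite -/(d u); have : 0 < u - x by rewrite subr_gt0.
  nra.
have [|c [uc cx h]] := @MVT_closed (fun x => W x `^ q) d u x ux.
  by move=> z uz zx; apply: is_derive_powR_prim;
    [exact: lt_le_trans uz|exact: le_lt_trans xb].
have : d c <= d u.
  by apply: derive_powR_prim_nincr => //; [exact: ltW|exact: lt_trans xb].
rewrite -/(d u); have : 0 < x - u by rewrite subr_gt0.
nra.
Qed.

End concave_power.

Lemma MVT_oo F w a b : a < b -> {within `[a, b], continuous F} ->
  (forall x, a < x -> x < b -> is_derive x 1 F (w x)) ->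
  exists c, [/\ a < c, c < b & F b - F a = w c * (b - a)].
Proof.
move=> ab cF hF; have [|c] := @MVT R F w a b ab _ cF.
  by move=> z; rewrite in_itv/= => /andP[xz zy]; exact: hF.
by rewrite in_itv/= => /andP[xc cy] h; exists c.
Qed.

(** The mean value theorem for [P] yields an interior point [u] with [u * w u = 0]; as [w u] is
    positive, [u] is the origin itself. *)
Lemma centroid_interior P w a b : a < b ->
  (forall x, a < x -> x < b -> 0 < w x) -> {within `[a, b], continuous P} ->
  (forall x, a < x -> x < b -> is_derive x 1 P (x * w x)) -> P a = P b ->
  a < 0 /\ 0 < b.
Proof.
move=> ab w_gt0 cP P' Pab; have [u [au ub]] := MVT_oo ab cP P'.
rewrite Pab subrr => /esym/eqP; rewrite !mulf_eq0.
by rewrite (gt_eqF (w_gt0 _ au ub)) subr_eq0 (gt_eqF ab) !orbF => /eqP <-.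
Qed.

(** * Comparison with the mean of a Beta density *)

Section beta_comparison.
Variables (a b al be : R) (phi d w h Z P : R -> R).
Hypothesis ab : a < b.
Hypothesis al0 : 0 < al.
Hypothesis be1 : 1 <= be.
Let c := al / (al + be).
Hypothesis phi' : forall x, a < x -> x < b -> is_derive x 1 phi (d x).
Hypothesis d_gt0 : forall x, a < x -> x < b -> 0 < d x.
Hypothesis phi_supp : forall u x, a < u -> u < b -> a < x -> x < b ->
  phi x <= phi u + d u * (x - u).
Hypothesis phi01 : forall x, a < x -> x < b -> 0 < phi x < 1.
Hypothesis phib : phi x @[x --> b^'-] --> (1 : R).
Hypothesis phic : exists u, [/\ a < u, u < b & phi u = c].
Hypothesis h_gt0 : forall x, a < x -> x < b -> 0 < h x.
Hypothesis h_ndecr : forall x y, a < x -> x <= y -> y < b -> h x <= h y.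
Hypothesis wE : forall x, a < x -> x < b ->
  w x = h x * (d x * phi x `^ (al - 1) * (1 - phi x) `^ (be - 1)).
Hypothesis cZ : {within `[a, b], continuous Z}.
Hypothesis cP : {within `[a, b], continuous P}.
Hypothesis Z' : forall x, a < x -> x < b -> is_derive x 1 Z (w x).
Hypothesis P' : forall x, a < x -> x < b -> is_derive x 1 P (x * w x).
Hypothesis Pab : P a = P b.

Let w_gt0 x : a < x -> x < b -> 0 < w x.
Proof.
move=> ax xb; have /andP[p0 p1] := phi01 ax xb.
by rewrite wE// !mulr_gt0 ?h_gt0 ?d_gt0 ?powR_gt0 ?subr_gt0.
Qed.

Let phi_ndecr x y : a < x -> x <= y -> y < b -> phi x <= phi y.
Proof. by apply: is_derive_ndecr phi' _ x y => x ax xb; exact/ltW/d_gt0. Qed.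

(** In the variable [phi], a primitive of [c - phi] against a multiple of the Beta density. As a
    function on the unit interval it vanishes at both ends, which is how the Beta mean [c] enters
    without any Beta integral. *)
Let Phi x := phi x `^ al * (1 - phi x) `^ be.

Let albe : 0 < al + be. Proof. by rewrite addr_gt0// (lt_le_trans _ be1). Qed.

Lemma is_derive_beta x : a < x -> x < b -> is_derive x 1 Phi
  ((al + be) * (d x * phi x `^ (al - 1) * (1 - phi x) `^ (be - 1)) * (c - phi x)).
Proof.
move=> ax xb; have /andP[p0 p1] := phi01 ax xb.
have p1' : 0 < 1 - phi x by rewrite subr_gt0.
have h1 := is_derive1_comp (is_derive1_powR al p0) (phi' ax xb).
have h2 : is_derive x 1 (fun x => 1 - phi x) (- d x).
  have hphi := phi' ax xb.
  by apply: (is_derive_eq (is_deriveB (is_derive_cst (1 : R) x 1) hphi)); rewrite sub0r.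
have h3 := @is_derive1_comp R (@powR R ^~ be) (fun x => 1 - phi x) x _ _
  (is_derive1_powR be p1') h2.
have h4 := is_deriveM h1 h3.
apply: (is_derive_eq h4) => /=.
rewrite /GRing.scale/= -{1}(@mulr_powRB1 _ (phi x) al (ltW p0) al0).
rewrite -(@mulr_powRB1 _ (1 - phi x) be (ltW p1') (lt_le_trans ltr01 be1)).
have -> : c = al / (al + be) by [].
by field; rewrite gt_eqF.
Qed.

(* [N] is nondecreasing: the support line of [phi] at the origin bounds
   [w (phi - c)] from above, and comparing [h] with its value where [phi = c]
   bounds it from below by a multiple of the derivative of the Beta density
   [- Phi]. *)
Lemma beta_comparison : c <= phi 0.
Proof.
have [a0 b0] := centroid_interior ab w_gt0 cP P' Pab.
have [u [au ub uc]] := phic.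
pose K := h u / (al + be).
have K0 : 0 < K by rewrite divr_gt0// h_gt0.
pose M x := (phi 0 - c) * Z x + d 0 * P x.
pose N x := M x + K * Phi x.
have N' x : a < x -> x < b -> is_derive x 1 N ((phi 0 - c) * w x +
   d 0 * (x * w x) + K * ((al + be) * (d x * phi x `^ (al - 1) *
     (1 - phi x) `^ (be - 1)) * (c - phi x))).
  move=> ax xb; have hZ := Z' ax xb; have hP := P' ax xb.
  have hPhi := is_derive_beta ax xb.
  have h1 := is_deriveD (is_deriveD (is_deriveZ (phi 0 - c) hZ)
    (is_deriveZ (d 0) hP)) (is_deriveZ K hPhi).
  by apply: (is_derive_eq h1).
have Nnd x y : a < x -> x <= y -> y < b -> N x <= N y.
  apply: is_derive_ndecr N' _ x y => x ax xb.
  have /andP[p0 p1] := phi01 ax xb.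
  have wx := w_gt0 ax xb.
  set k := d x * _ * _; have k0 : 0 < k.
    by rewrite !mulr_gt0 ?d_gt0 ?powR_gt0 ?subr_gt0.
  have wk : w x = h x * k by rewrite wE.
  have supp := phi_supp a0 b0 ax xb.
  rewrite subr0 in supp.
  have -> : K * ((al + be) * k * (c - phi x)) = h u * k * (c - phi x).
    by rewrite /K; field; rewrite gt_eqF.
  have s1 : (phi x - c) * w x <= (phi 0 - c) * w x + d 0 * (x * w x) by nra.
  (* Both factors are nondecreasing in [x] and vanish at [u]. *)
  suff : 0 <= (phi x - c) * (h x - h u).
    by rewrite wk in s1 *; nra.
  rewrite -uc; have [xu|ux] := leP x u.
    by rewrite mulr_le0// subr_le0; [exact: phi_ndecr|exact: h_ndecr].
  by rewrite mulr_ge0// subr_ge0; [apply: phi_ndecr|apply: h_ndecr] => //; exact: ltW.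
(* Towards [a] the sign of [Phi] suffices; towards [b] the upper bound, which comes from [1 <= be],
   sends it to 0. *)
have PhiL x : a < x -> x < b -> 0 <= Phi x <= 1 - phi x.
  move=> ax xb; have /andP[p0 p1] := phi01 ax xb.
  rewrite mulr_ge0 ?powR_ge0//= -[leRHS]mul1r ler_pM ?powR_ge0//.
    rewrite -[leRHS](powRr0 (phi x)).
    by apply: ger_powR; rewrite ?p0 ?ltW.
  by apply: ge1r_powR => //; rewrite subr_gt0 p1 gerBl ltW.
have cMa : M x @[x --> a^'+] --> M a.
  by apply: cvgD; apply: cvgM; try exact: cvg_cst;
    [exact: (within_cvg_left ab cZ)|exact: (within_cvg_left ab cP)].
have cMb : M x + K * (1 - phi x) @[x --> b^'-] --> M b.
  rewrite -[M b]addr0 -(mulr0 K) -(subrr 1).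
  apply: cvgD.
    by apply: cvgD; apply: cvgM; try exact: cvg_cst;
      [exact: (within_cvg_right ab cZ)|exact: (within_cvg_right ab cP)].
  by apply: cvgM; [exact: cvg_cst|apply: cvgB => //; exact: cvg_cst].
have Mab : M a <= M b.
  apply: (at_left_ge ab cMb) => y ay yb.
  apply: (at_right_le ay cMa) => x ax xy.
  apply: (@le_trans _ _ (N x)).
    have /andP[h1 _] := PhiL x ax (lt_trans xy yb).
    by rewrite /N lerDl mulr_ge0// ltW.
  apply: le_trans (Nnd _ _ ax (ltW xy) yb) _.
  have /andP[_ h1] := PhiL y ay yb.
  by rewrite /N lerD2l ler_pM2l.
(* As [P a = P b], [M b - M a] is [(phi 0 - c) * (Z b - Z a)]; it remains to see that the weight has
   positive mass. *)
have [v [av vb Zab]] := MVT_oo ab cZ Z'.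
have : 0 < Z b - Z a by rewrite Zab mulr_gt0 ?subr_gt0// w_gt0.
move: Mab; rewrite /M Pab; nra.
Qed.

End beta_comparison.
End calculus.

(** * The bounds for the two ranges of [r] *)

Section powered_centroids.
Context {R : realType}.
Implicit Types (F dF G W f : R -> R) (a b p q r s t x y : R).

(** In other words, [G x / (b - x)] is nondecreasing. The right end of the chord tends to [b] and
    its term is dropped by sign, because [G] may have a jump there. *)
Lemma concave_oo_right G a b : concave_oo G a b ->
  (forall y, a < y -> y < b -> 0 <= G y) ->
  forall s t, a < s -> s < t -> t < b -> G s * (b - t) <= G t * (b - s).
Proof.
move=> cG G0 s t as_ st tb; rewrite -subr_le0.
have cF : G s * (y - t) - G t * (y - s) @[y --> b^'-] -->
    (G s * (b - t) - G t * (b - s) : R).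
  apply: cvgB; apply: cvgM; try exact: cvg_cst;
  by apply: cvgB; [apply: cvg_at_left_filter; exact: cvg_id|exact: cvg_cst].
apply: (at_left_le tb cF) => y ty yb.
have := cG _ _ _ as_ st ty yb.
have : 0 <= G y * (t - s).
  apply: mulr_ge0; last by rewrite subr_ge0 ltW.
  by apply: G0 => //; exact/(lt_trans as_)/(lt_trans st).
lra.
Qed.

(** Here the limit at [b] is kept: [(l - G x) / (b - x)] is nonincreasing. It is applied to [phi],
    whose limit is 1. *)
Lemma concave_oo_right_lim G a b (l : R) : concave_oo G a b ->
  G x @[x --> b^'-] --> l ->
  forall s t, a < s -> s < t -> t < b ->
    G s * (b - t) + l * (t - s) <= G t * (b - s).
Proof.
move=> cG Gl s t as_ st tb; rewrite -subr_le0.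
have cF : G s * (y - t) + G y * (t - s) - G t * (y - s) @[y --> b^'-] -->
    (G s * (b - t) + l * (t - s) - G t * (b - s) : R).
  apply: cvgB; [apply: cvgD|]; apply: cvgM; try exact: cvg_cst; try exact: Gl;
  by apply: cvgB; [apply: cvg_at_left_filter; exact: cvg_id|exact: cvg_cst].
apply: (at_left_le tb cF) => y ty yb.
by rewrite subr_le0; exact: cG.
Qed.

Lemma cvg_powR (T : Type) (F : set_system T) {FF : Filter F} (g : T -> R) (l e : R) :
  0 < l -> g x @[x --> F] --> l -> g x `^ e @[x --> F] --> l `^ e.
Proof.
move=> l0 gl; apply: (@cvg_comp _ _ _ g (@powR R ^~ e) F (nbhs l)) => //.
have [+ _] := is_derive1_powR e l0.
by move/derivable1_diffP/differentiable_continuous.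
Qed.

Lemma gt0_powRD x e1 e2 : 0 < x -> x `^ e1 * x `^ e2 = x `^ (e1 + e2).
Proof. by move=> x0; rewrite powRD// (gt_eqF x0) implybT. Qed.

Lemma gt0_powRB1 x e : 0 < x -> x `^ (e - 1) * x = x `^ e.
Proof. by move=> x0; rewrite -{2}(powRr1 (ltW x0)) gt0_powRD// subrK. Qed.

Section powered_grunbaum.
Variables (a b p r : R) (f W Z P : R -> R).
Hypothesis ab : a < b.
Hypothesis p0 : 0 < p.
Hypothesis r0 : 0 <= r.
Hypothesis f_gt0 : forall x, a < x -> x < b -> 0 < f x.
Hypothesis fconc : concave_oo (fun x => f x `^ p) a b.
Hypothesis W' : forall x, a < x -> x < b -> is_derive x 1 W (f x).
Hypothesis Z' : forall x, a < x -> x < b -> is_derive x 1 Z (f x `^ r).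
Hypothesis P' : forall x, a < x -> x < b -> is_derive x 1 P (x * f x `^ r).
Hypothesis cW : {within `[a, b], continuous W}.
Hypothesis cZ : {within `[a, b], continuous Z}.
Hypothesis cP : {within `[a, b], continuous P}.
Hypothesis Wa : W a = 0.
Hypothesis Wb : W b = 1.
Hypothesis Pab : P a = P b.

Let q := p / (p + 1).
Let phi x := W x `^ q.
Let d x := q * W x `^ (q - 1) * f x.

Let p1 : 0 < p + 1. Proof. by rewrite addr_gt0. Qed.
Let q0 : 0 < q. Proof. by rewrite divr_gt0. Qed.
Let q0' : q != 0. Proof. by rewrite gt_eqF. Qed.
Let W_gt0 x : a < x -> x < b -> 0 < W x.
Proof. exact: (prim_gt0 ab f_gt0 W' cW Wa). Qed.

Let W_lt1 x : a < x -> x < b -> W x < 1.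
Proof.
move=> ax xb; have [xy yb] := midf_lt xb; set y := (x + b) / 2 in xy yb.
have [|c [xc cy h]] := @MVT_closed _ W f x y xy.
  by move=> z xz zy; apply: W'; [exact: lt_le_trans xz|exact: le_lt_trans yb].
apply: (@lt_le_trans _ _ (W y)).
  rewrite -subr_gt0 h mulr_gt0 ?subr_gt0//.
  by apply: f_gt0; [exact: lt_trans xc|exact: lt_trans yb].
rewrite -Wb; apply: (at_left_ge yb (within_cvg_right ab cW)) => z yz zb.
apply: (is_derive_ndecr W' _ _ (ltW yz) zb); last exact: lt_trans xy.
by move=> u au ub; exact/ltW/f_gt0.
Qed.

Let phi01 x : a < x -> x < b -> 0 < phi x < 1.
Proof.
move=> ax xb; rewrite powR_gt0 ?W_gt0//=.
rewrite -[ltRHS](_ : 1 `^ q = 1); last by rewrite powR1.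
by apply: gt0_ltr_powR; rewrite ?nnegrE ?ltW ?W_gt0 ?W_lt1.
Qed.

Let d_gt0 x : a < x -> x < b -> 0 < d x.
Proof.
move=> ax xb; apply: mulr_gt0; last exact: f_gt0.
by apply: mulr_gt0 => //; exact/powR_gt0/W_gt0.
Qed.

Let phib : phi x @[x --> b^'-] --> (1 : R).
Proof.
rewrite -(_ : W b `^ q = 1); last by rewrite Wb powR1.
apply: cvg_powR; first by rewrite Wb.
exact: (within_cvg_right ab cW).
Qed.

Let phic c : 0 < c -> c < 1 -> exists u, [/\ a < u, u < b & phi u = c].
Proof.
move=> c0 c1; have v0 : 0 < c `^ q^-1 by rewrite powR_gt0.
have v1 : c `^ q^-1 < 1.
  rewrite -[ltRHS](_ : 1 `^ q^-1 = 1); last by rewrite powR1.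
  by apply: gt0_ltr_powR; rewrite ?nnegrE ?invr_gt0 ?ltW.
have [|u] := @IVT R W a b (c `^ q^-1) (ltW ab) cW.
  by rewrite Wa Wb minEle maxEle ler01 !ltW.
rewrite in_itv/= !le_eqVlt => /andP[/predU1P[<-|au]].
  by rewrite Wa => _ v; rewrite v ltxx in v0.
case/predU1P => [->|ub] uc; first by rewrite -uc Wb ltxx in v1.
by exists u; split => //; rewrite /phi uc -powRrM mulVf// powRr1// ltW.
Qed.

Let Wphi e x : phi x `^ e = W x `^ (q * e).
Proof. by rewrite powRrM. Qed.

Let d_powR e x : a < x -> x < b -> d x `^ e = q `^ e * W x `^ ((q - 1) * e) * f x `^ e.
Proof.
move=> ax xb; have fx := f_gt0 ax xb; have q_ge0 := ltW q0; have qW : 0 <= q * W x `^ (q - 1).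
  by apply: mulr_ge0 => //; exact: powR_ge0.
by rewrite /d (powRM _ qW (ltW fx)) (powRM _ q_ge0 (powR_ge0 _ _)) -powRrM.
Qed.

Let zero_in : a < 0 /\ 0 < b.
Proof.
apply: (centroid_interior ab _ cP P' Pab) => x ax xb.
exact/powR_gt0/f_gt0.
Qed.

Let conclude c : c <= phi 0 -> 0 <= c -> a < 0 -> 0 < b ->
  c `^ ((p + 1) / p) <= W 0.
Proof.
move=> cphi c0 a0 b0.
have -> : W 0 = phi 0 `^ ((p + 1) / p).
  rewrite Wphi /q mulrA divfK ?gt_eqF// divff ?gt_eqF// powRr1// ltW//.
  exact: W_gt0.
apply: ge0_ler_powR; rewrite ?nnegrE ?powR_ge0// ltW// divr_gt0//.
Qed.

Let phi' x : a < x -> x < b -> is_derive x 1 phi (d x).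
Proof. exact: (is_derive_powR_prim ab f_gt0 W' cW Wa). Qed.

Let supp u x : a < u -> u < b -> a < x -> x < b ->
  phi x <= phi u + d u * (x - u).
Proof. exact: (powR_prim_support p0 ab f_gt0 fconc W' cW Wa). Qed.

(* Here [f] is [d phi ^ (1 / p) / q], so [f ^ r] is [d phi ^ (r / p)] times
   [q ^ - r d ^ (r - 1)], which is nondecreasing because [d] is nonincreasing. *)
Lemma powered_grunbaum_le1 : r <= 1 ->
  ((p + r) / (2 * p + r)) `^ ((p + 1) / p) <= W 0.
Proof.
move=> r1; pose al := r / p + 1.
have al0 : 0 < al by rewrite ltr_wpDl// divr_ge0// ltW.
have cE : al / (al + 1) = (p + r) / (2 * p + r).
  rewrite /al; field; rewrite !gt_eqF//; have := p0; have := r0; lra.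
pose h x := q `^ (- r) * d x `^ (r - 1).
have h_gt0 x : a < x -> x < b -> 0 < h x.
  by move=> ax xb; rewrite mulr_gt0 ?powR_gt0 ?d_gt0.
have wE x : a < x -> x < b ->
    f x `^ r = h x * (d x * phi x `^ (al - 1) * (1 - phi x) `^ (1 - 1)).
  move=> ax xb; have dx := d_gt0 ax xb; have Wx := W_gt0 ax xb.
  have hd : d x `^ (r - 1) * d x = d x `^ r.
    exact: gt0_powRB1.
  have -> : h x * (d x * phi x `^ (al - 1) * (1 - phi x) `^ (1 - 1)) =
      q `^ (- r) * (d x `^ (r - 1) * d x) * phi x `^ (al - 1).
    by rewrite subrr powRr0 /h; ring.
  rewrite hd d_powR// Wphi powRN.
  have -> : (q `^ r)^-1 * (q `^ r * W x `^ ((q - 1) * r) * f x `^ r) *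
     W x `^ (q * (al - 1)) = (q `^ r / q `^ r) *
     (W x `^ ((q - 1) * r) * W x `^ (q * (al - 1))) * f x `^ r by ring.
  rewrite divff ?gt_eqF ?powR_gt0// gt0_powRD//.
  (* The powers of [W] must cancel for the weight to depend on [phi] and [d] alone; this determines
     [al]. *)
  have -> : (q - 1) * r + q * (al - 1) = 0.
    by rewrite /q /al; field; rewrite !gt_eqF.
  by rewrite powRr0 !mul1r.
have h_nd x y : a < x -> x <= y -> y < b -> h x <= h y.
  move=> ax xy yb; rewrite ler_pM2l ?powR_gt0//.
  have dx := d_gt0 ax (le_lt_trans xy yb); have dy := d_gt0 (lt_le_trans ax xy) yb.
  rewrite -[r - 1]opprK powRN [leRHS]powRN lef_pV2 ?posrE ?powR_gt0//.
  apply: ge0_ler_powR; rewrite ?nnegrE ?(ltW dx) ?(ltW dy)// ?opprB ?subr_ge0//.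
  exact: (derive_powR_prim_nincr p0 ab f_gt0 fconc W' cW Wa).
have c0 : 0 < al / (al + 1) by rewrite divr_gt0// addr_gt0.
have c1 : al / (al + 1) < 1 by rewrite ltr_pdivrMr ?mul1r ?ltrDl// addr_gt0.
have [a0 b0] := zero_in.
rewrite -cE; apply: conclude => //; last exact: ltW.
exact: (beta_comparison ab al0 (lexx 1) phi' d_gt0 supp phi01 phib (phic c0 c1)
  h_gt0 h_nd wE cZ cP Z' P' Pab).
Qed.

(* The factor [h] is nondecreasing because [f ^ p] is concave and nonnegative
   while [1 - phi] is convex and vanishes at [b]. *)
Lemma powered_grunbaum_ge1 : 1 <= r ->
  ((p + 1) / (2 * p + r)) `^ ((p + 1) / p) <= W 0.
Proof.
move=> r1; pose al := 1 / p + 1; pose be := (r - 1) / p + 1.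
have al0 : 0 < al by rewrite ltr_wpDl// divr_ge0// ltW.
have be1 : 1 <= be by rewrite lerDr divr_ge0 ?subr_ge0// ltW.
have cE : al / (al + be) = (p + 1) / (2 * p + r).
  by rewrite /al /be; field; rewrite !gt_eqF//; have := p0; have := r0; lra.
pose G x := f x `^ p.
have G_gt0 x : a < x -> x < b -> 0 < G x.
  by move=> ax xb; rewrite powR_gt0 ?f_gt0.
have phi1 x : a < x -> x < b -> 0 < 1 - phi x.
  by move=> ax xb; have /andP[_] := phi01 ax xb; rewrite subr_gt0.
(* Only one factor [f] of [f ^ r] is rewritten as [d * phi ^ (1 / p) / q]; the remaining
   [f ^ (r - 1)] is [G ^ ((r - 1) / p)]. *)
pose h x := q^-1 * (G x / (1 - phi x)) `^ ((r - 1) / p).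
have h_gt0 x : a < x -> x < b -> 0 < h x.
  by move=> ax xb; rewrite mulr_gt0 ?invr_gt0// powR_gt0// divr_gt0 ?G_gt0 ?phi1.
have wE x : a < x -> x < b ->
    f x `^ r = h x * (d x * phi x `^ (al - 1) * (1 - phi x) `^ (be - 1)).
  move=> ax xb; have dx := d_gt0 ax xb; have Wx := W_gt0 ax xb.
  have fx := f_gt0 ax xb; have p1x := phi1 _ ax xb.
  rewrite /h powRM ?powR_ge0 ?invr_ge0 ?(ltW p1x)//.
  rewrite /G -powRrM mulrC [p * _]mulrC divfK ?gt_eqF//.
  rewrite -(powR_inv1 (ltW p1x)) -powRrM mulN1r powRN.
  have -> : be - 1 = (r - 1) / p by rewrite /be addrK.
  rewrite Wphi /d.
  set A := _ `^ ((r - 1) / p).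
  have A0 : A != 0 by rewrite gt_eqF// powR_gt0.
  have -> : q * W x `^ (q - 1) * f x * W x `^ (q * (al - 1)) * A *
     (q^-1 * (f x `^ (r - 1) * A^-1)) =
     W x `^ (q - 1) * W x `^ (q * (al - 1)) * (f x `^ (r - 1) * f x).
    by field; rewrite A0 q0'.
  rewrite gt0_powRD//.
  have -> : (q - 1) + q * (al - 1) = 0.
    by rewrite /q /al; field; rewrite !gt_eqF.
  by rewrite powRr0 mul1r gt0_powRB1.
have h_nd x y : a < x -> x <= y -> y < b -> h x <= h y.
  move=> ax; rewrite le_eqVlt => /predU1P[->//|xy] yb.
  have xb := lt_trans xy yb; have ay := lt_trans ax xy.
  have iq : 0 < q^-1 by rewrite invr_gt0.
  apply: ler_wpM2l; first exact: ltW.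
  have [Gx Gy] := (G_gt0 _ ax xb, G_gt0 _ ay yb).
  have [px py] := (phi1 _ ax xb, phi1 _ ay yb).
  apply: ge0_ler_powR; rewrite ?nnegrE ?(ltW (divr_gt0 Gx px))
    ?(ltW (divr_gt0 Gy py)) ?divr_ge0 ?subr_ge0 ?(ltW p0)//.
  rewrite ler_pdivrMr// mulrAC ler_pdivlMr//.
  have h1 := concave_oo_right fconc (fun y ay yb => ltW (G_gt0 y ay yb)) ax xy yb.
  have h2 := concave_oo_right_lim (powR_prim_conc p0 ab f_gt0 fconc W' cW Wa)
    phib ax xy yb.
  have bx : 0 < b - x by rewrite subr_gt0.
  rewrite -(ler_pM2r bx).
  apply: (@le_trans _ _ (G x * (b - y) * (1 - phi x))).
    rewrite -!mulrA ler_pM2l//; move: h2; rewrite -/(phi x) -/(phi y); lra.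
  by rewrite [leRHS]mulrAC ler_pM2r.
have c0 : 0 < al / (al + be) by rewrite divr_gt0// addr_gt0// (lt_le_trans _ be1).
have c1 : al / (al + be) < 1.
  rewrite ltr_pdivrMr ?mul1r ?ltrDl ?(lt_le_trans _ be1)//.
  by rewrite addr_gt0// (lt_le_trans _ be1).
have [a0 b0] := zero_in.
rewrite -cE; apply: conclude => //; last exact: ltW.
exact: (beta_comparison ab al0 be1 phi' d_gt0 supp phi01 phib (phic c0 c1)
  h_gt0 h_nd wE cZ cP Z' P' Pab).
Qed.

End powered_grunbaum.
End powered_centroids.

(** * One-dimensional integrals of Lipschitz functions *)

Section one_dim.
Context {R : realType}.
Notation mu := (@lebesgue_measure R).
Implicit Types (f g : R -> R) (B C t s v : R).

(* [N] is a bare function standing for a norm, so that functions of several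
   variables are covered by [prodN] without building normed structures. *)
Definition lipc (T : zmodType) (N : T -> R) (B C : R) (g : T -> R) :=
  [/\ forall x, B < N x -> g x = 0, forall x, 0 <= g x <= C &
      exists2 L, 0 <= L & forall x y, `|g x - g y| <= L * N (x - y)].

Definition prodN (T1 T2 : zmodType) (N1 : T1 -> R) (N2 : T2 -> R) (z : T1 * T2) : R :=
  N1 z.1 + N2 z.2.

Lemma lipc_comp (T T' : zmodType) (N : T -> R) (N' : T' -> R) (h : T' -> T)
    (B B' C K : R) (g : T -> R) : lipc N B C g -> 0 <= K ->
  (forall x y, N (h x - h y) <= K * N' (x - y)) ->
  (forall x, B' < N' x -> B < N (h x)) ->
  lipc N' B' C (g \o h).
Proof.
move=> [gB gC [L L0 gL]] K0 hK hB; split => [x /hB/gB//|x|]; first exact: gC.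
exists (L * K); first exact: mulr_ge0.
move=> x y; rewrite -mulrA; apply: le_trans (gL _ _) _.
by rewrite ler_wpM2l.
Qed.

Lemma lipc_continuous B C f : lipc Num.norm B C f -> continuous f.
Proof.
move=> [_ _ [L L0 fL]] x; apply/cvgrPdist_le => e e0; near=> y.
apply: le_trans (fL _ _) _.
apply: (@le_trans _ _ ((L + 1) * `|x - y|)); first by rewrite ler_wpM2r// lerDl.
rewrite mulrC -ler_pdivlMr ?ltr_wpDl//.
near: y; apply: cvgr_dist_le; [exact: cvg_id|].
by rewrite divr_gt0// ltr_wpDl.
Unshelve. all: by end_near. Qed.

Lemma supp_Rintegral (D : set R) f : (forall t, ~ D t -> f t = 0) ->
  \int[mu]_(t in D) f t = \int[mu]_t f t.
Proof.
move=> Df; rewrite Rintegral_mkcond; congr (Rintegral _ _ _); apply/funext => t.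
by rewrite patchE; case: ifPn => // /negP tD; rewrite Df// => Dt; apply: tD; rewrite inE.
Qed.

Lemma bounded_integrable (D : set R) f B C : measurable D -> measurable_fun setT f ->
  (forall t, `|f t| <= C) -> (forall t, B < `|t| -> f t = 0) ->
  mu.-integrable D (EFin \o f).
Proof.
move=> mD mf fC fB; apply: (@integrableS _ _ _ _ setT) => //.
have itvB : measurable (`[- B, B] : set R) by [].
have fi : mu.-integrable `[- B, B] (EFin \o f).
  apply: measurable_bounded_integrable => //.
  - by rewrite /= lebesgue_measure_itv/=; case: ifP => _ //; rewrite -EFinD ltry.
  - exact: measurable_funS mf.
  - exists C; split; first exact: num_real.
    by move=> x Cx t _ /=; apply: le_trans (fC t) (ltW Cx).
have [h _] := @integrable_mkcond _ _ R mu `[- B, B] (EFin \o f) itvB.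
rewrite (_ : EFin \o f = (EFin \o f) \_ (`[- B, B])); first exact: h.
apply/funext => t; rewrite patchE; case: ifPn => // /negP tB /=.
rewrite fB// ltNge; apply/negP => h'; apply: tB.
by rewrite inE/= in_itv/= -ler_norml.
Qed.

Lemma lipc_measurable B C f : lipc Num.norm B C f -> measurable_fun setT f.
Proof. by move=> /lipc_continuous; exact: continuous_measurable_fun. Qed.

Lemma lipc_integrable (D : set R) B C f : measurable D -> lipc Num.norm B C f ->
  mu.-integrable D (EFin \o f).
Proof.
move=> mD fl; have [fB fC _] := fl.
apply: (@bounded_integrable _ _ B C) => //; first exact: lipc_measurable fl.
by move=> t; have /andP[f0 ?] := fC t; rewrite ger0_norm.
Qed.

Lemma Rintegral_supp_bound f B C : 0 <= B -> measurable_fun setT f ->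
  (forall t, `|f t| <= C) -> (forall t, B < `|t| -> f t = 0) ->
  `|\int[mu]_t f t| <= C * (2 * B).
Proof.
move=> B0 mf fC fB; rewrite -(@supp_Rintegral `[- B, B]); last first.
  move=> t /= h; apply: fB; rewrite ltNge; apply/negP => h'; apply: h.
  by rewrite in_itv/= -ler_norml.
have itvB : measurable (`[- B, B] : set R) by [].
have fi := bounded_integrable itvB mf fC fB.
apply: (le_trans (@le_normr_Rintegral _ (measurableTypeR R) R mu _ _ itvB fi)).
have h : mu.-integrable `[- B, B] (EFin \o cst C).
  apply: measurable_bounded_integrable => //.
  + by rewrite /= lebesgue_measure_itv/=; case: ifP => _ //; rewrite -EFinD ltry.
  + by exists `|C|; split; [exact: num_real|move=> x Cx t _ /=; exact: ltW].
apply: (@le_trans _ _ (\int[mu]_(t in `[- B, B]) C)).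
  apply: le_Rintegral => //.
  by have := integrable_norm fi.
rewrite Rintegral_cst//= lebesgue_measure_itv/= lte_fin.
case: ifPn => [_|]; first by rewrite -EFinD/= opprK mulr2n mulrDl mul1r lexx.
by rewrite mulr0 mulr_ge0 ?mulr_ge0//; exact: le_trans (fC 0).
Qed.

(** The reflection [t -> v - t] is the substitution that exchanges the two factors of a convolution;
    translations are obtained by composing two reflections. *)
Lemma lebesgue_measure_subl v (A : set R) : measurable A ->
  pushforward mu ((fun t => v - t) : R -> measurableTypeR R) A = mu A.
Proof.
move=> mA.
have mv : measurable_fun setT ((fun t => v - t) : measurableTypeR R -> measurableTypeR R).
  by apply: measurable_funB.
apply/esym/lebesgue_measure_unique => //= _ [[a b]] _ <-.
rewrite /pushforward (_ : _ @^-1` _ = `[v - b, v - a[%classic); last first.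
  by apply/seteqP; split => t /=; rewrite !in_itv/= => /andP[h1 h2]; apply/andP; split; lra.
rewrite !lebesgue_measure_itv/= !lte_fin ltrD2l ltrN2; case: ifPn => // ab.
by rewrite -!EFinD; congr EFin; ring.
Qed.

(** For the product sigma-algebra, a superlevel set is a countable union of squares with rational
    centre and radius on which the Lipschitz bound keeps [F] above [c]. *)
Lemma measurable_lip2 (B C : R) (F : R * R -> R) :
  lipc (prodN Num.norm Num.norm) B C F -> measurable_fun setT F.
Proof.
move=> [_ _ [L L0 FL]].
apply: (measurability _ (RGenOInfty.measurableE R)) => _ [_ [c ->] <-].
rewrite setTI.
pose box (x y r : rat) : set (R * R) := [set z |
  [/\ c < F (ratr x, ratr y) - L * (ratr r + ratr r), `|z.1 - ratr x| < ratr r & `|z.2 - ratr y| < ratr r]].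
have -> : F @^-1` `]c, +oo[ = \bigcup_x \bigcup_y \bigcup_r box x y r.
  apply/seteqP; split => [[s t]/=|[s t] [x _ [y _ [r _ [cF sx ty]]]]]/=; last first.
    rewrite in_itv/= andbT; apply: lt_le_trans cF _.
    have := FL (ratr x, ratr y) (s, t); rewrite ler_norml => /andP[_ h].
    rewrite lerBlDr -lerBlDl; apply: le_trans h _.
    by rewrite ler_wpM2l// /prodN/= lerD// distrC ltW.
  rewrite in_itv/= andbT => cF.
  (* Passing to the rational centre costs [2 * L * r] and the margin in [box] another [2 * L * r],
     hence a divisor above 4; [L + 1] is positive even if [L = 0]. *)
  pose e := (F (s, t) - c) / (L + 1) / 5.
  have L1 : 0 < L + 1 by rewrite ltr_wpDl.
  have e0 : 0 < e by rewrite !divr_gt0// subr_gt0.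
  have [r] := rat_in_itvoo e0; rewrite in_itv/= => /andP[r0 re].
  have sr : s - ratr r < s + ratr r by lra.
  have [x] := rat_in_itvoo sr; rewrite in_itv/= => /andP[xs sx].
  have tr : t - ratr r < t + ratr r by lra.
  have [y] := rat_in_itvoo tr; rewrite in_itv/= => /andP[yt ty].
  have sx' : `|s - ratr x| < ratr r by rewrite ltr_norml; apply/andP; split; lra.
  have ty' : `|t - ratr y| < ratr r by rewrite ltr_norml; apply/andP; split; lra.
  exists x => //; exists y => //; exists r => //; split => //=.
  have := FL (s, t) (ratr x, ratr y); rewrite ler_norml => /andP[_ h].
  have h1 : F (s, t) - F (ratr x, ratr y) <= L * (ratr r + ratr r).
    apply: le_trans h _; rewrite ler_wpM2l// /prodN/=; lra.
  have h2 : (L + 1) * (5 * e) = F (s, t) - c.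
    by rewrite /e; field; rewrite gt_eqF.
  have : L * ratr r <= L * e by rewrite ler_wpM2l// ltW.
  nra.
apply: bigcupT_measurable_rat => x; apply: bigcupT_measurable_rat => y.
apply: bigcupT_measurable_rat => r.
have [h|h] := pselect (c < F (ratr x, ratr y) - L * (ratr r + ratr r)); last first.
  rewrite (_ : box x y r = set0)//; apply/seteqP; split => // z [] //.
rewrite (_ : box x y r = (fun z : R * R => z.1) @^-1` (ball (ratr x : R) (ratr r)) `&`
  (fun z : R * R => z.2) @^-1` (ball (ratr y : R) (ratr r))).
  apply: measurableI; rewrite -[X in measurable X]setTI.
    by apply: measurable_fst => //; exact: measurable_ball.
  by apply: measurable_snd => //; exact: measurable_ball.
apply/seteqP; split => [z [_ h1 h2]|z [h1 h2]]; split => //=; rewrite /ball/= in h1 h2 *;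
by rewrite distrC.
Qed.

Lemma Rintegral_swap B C (F : R * R -> R) : 0 <= B ->
  lipc (prodN Num.norm Num.norm) B C F ->
  \int[mu]_s \int[mu]_t F (s, t) = \int[mu]_t \int[mu]_s F (s, t).
Proof.
move=> B0 Fl; have [FB FC FL] := Fl.
have F1 s : lipc Num.norm B C (fun t => F (s, t)).
  apply: (@lipc_comp _ _ _ _ (fun t => (s, t)) B B C 1 F Fl) => // [x y|x].
    by rewrite /prodN/= subrr normr0 add0r mul1r.
  by rewrite /prodN/= => h; rewrite ltr_wpDl.
have F2 t : lipc Num.norm B C (fun s => F (s, t)).
  apply: (@lipc_comp _ _ _ _ (fun s => (s, t)) B B C 1 F Fl) => // [x y|x].
    by rewrite /prodN/= subrr normr0 addr0 mul1r.
  by rewrite /prodN/= => h; rewrite ltr_wpDr.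
rewrite /Rintegral; congr fine.
under eq_integral => s _ do
  rewrite (fineK (integrable_fin_num measurableT (lipc_integrable measurableT (F1 s)))).
under [RHS]eq_integral => t _ do
  rewrite (fineK (integrable_fin_num measurableT (lipc_integrable measurableT (F2 t)))).
apply: (@fubini_tonelli _ _ _ _ _ mu mu (EFin \o F)).
  by apply/measurable_EFinP; exact: measurable_lip2 Fl.
by move=> z /=; rewrite lee_fin; have /andP[] := FC z.
Qed.

Lemma Rintegral_subl B C v f : lipc Num.norm B C f ->
  \int[mu]_t f (v - t) = \int[mu]_t f t.
Proof.
move=> fl; have [_ fC _] := fl; congr fine.
have mf := lipc_measurable fl.
have mv : measurable_fun setT ((fun t => v - t) : measurableTypeR R -> measurableTypeR R).
  by apply: measurable_funB.
rewrite -[in LHS](preimage_setT ((fun t => v - t) : R -> measurableTypeR R)).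
rewrite -(@ge0_integral_pushforward _ _ (measurableTypeR R) (measurableTypeR R) R _ mv mu setT (EFin \o f))//=.
- by apply: eq_measure_integral => //= A mA AS; exact: lebesgue_measure_subl.
- exact/measurable_EFinP.
- by move=> y _; rewrite lee_fin; have /andP[] := fC y.
Qed.

Lemma Rintegral_gt0 B C f x : lipc Num.norm B C f -> 0 < f x ->
  0 < \int[mu]_t f t.
Proof.
move=> fl fx; have [fB fC [L L0 fL]] := fl.
have L1 : 0 < L + 1 by rewrite ltr_wpDl.
pose e := f x / (L + 1) / 2.
have e0 : 0 < e by rewrite !divr_gt0.
have eL : (L + 1) * (2 * e) = f x by rewrite /e; field; rewrite gt_eqF.
have itvx : measurable (`[x - e, x + e] : set R) by [].
have fi D : measurable D -> mu.-integrable D (EFin \o f).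
  by move=> mD; exact: lipc_integrable fl.
have muI : mu `[x - e, x + e] = (2 * e)%:E.
  rewrite lebesgue_measure_itv/= lte_fin ifT; last by lra.
  by rewrite -EFinD; congr EFin; lra.
apply: (@lt_le_trans _ _ (\int[mu]_(t in `[x - e, x + e]) (f x / 2))).
  by rewrite Rintegral_cst//= muI/= !mulr_gt0 ?invr_gt0.
apply: (@le_trans _ _ (\int[mu]_(t in `[x - e, x + e]) f t)).
  apply: le_Rintegral => //; [|exact: fi|].
    apply: measurable_bounded_integrable => //=; first by rewrite muI ltry.
    by exists `|f x / 2|; split; [exact: num_real|move=> y Cy t _ /=; exact: ltW].
  move=> t/=; rewrite in_itv/= => /andP[h1 h2].
    have := fL x t; rewrite ler_norml => /andP[_ h].
    have h3 : `|x - t| <= e by rewrite ler_norml; apply/andP; split; lra.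
    have h4 : L * `|x - t| <= L * e by rewrite ler_wpM2l.
    nra.
rewrite Rintegral_mkcond; apply: le_Rintegral => //.
- rewrite -restrict_EFin.
  have [h _] := @integrable_mkcond _ _ R mu _ (EFin \o f) itvx.
  by apply: h; exact: fi.
- exact: fi.
- by move=> t _; rewrite patchE; case: ifP => // _; have /andP[] := fC t.
Qed.

End one_dim.

(** * Iterated integrals *)

Section iterated.
Context {R : realType}.
Notation mu := (@lebesgue_measure R).
Implicit Types (B C e t s v : R) (m n : nat).

(** This norm is additive along [vcons] and agrees with [prodN] on products, so splitting off a
    coordinate preserves the bounds [B] and [C] of [lipc]. *)
Definition l1norm n (x : 'rV[R]_n) : R := \sum_i `|x 0 i|.

Definition vcons n (t : R) (y : 'rV[R]_n) : 'rV[R]_n.+1 :=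
  row_mx (\row_(i < 1) t) y.

Lemma vcons_0 n t (y : 'rV[R]_n) : vcons t y 0 ord0 = t.
Proof. by rewrite /vcons mxE; case: splitP => j //= _; rewrite mxE. Qed.

Lemma vcons_lift n t (y : 'rV[R]_n) i : vcons t y 0 (lift ord0 i) = y 0 i.
Proof.
rewrite /vcons mxE; case: splitP => j /=; rewrite /bump leq0n => ij.
  by have := ltn_ord j; rewrite -ij.
by congr (y _ _); apply/val_inj; case: ij.
Qed.

Lemma rV_ord0_lift n (x y : 'rV[R]_n.+1) : x 0 ord0 = y 0 ord0 ->
  (forall i, x 0 (lift ord0 i) = y 0 (lift ord0 i)) -> x = y.
Proof. by move=> h0 h; apply/rowP => i; case: (unliftP ord0 i) => [j ->|->]. Qed.

Lemma l1norm_vcons n t (y : 'rV[R]_n) : l1norm (vcons t y) = `|t| + l1norm y.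
Proof.
by rewrite /l1norm big_ord_recl vcons_0; under eq_bigr do rewrite vcons_lift.
Qed.

Lemma vconsB n t s (y z : 'rV[R]_n) :
  vcons t y - vcons s z = vcons (t - s) (y - z).
Proof.
have subE k (x x' : 'rV[R]_k) i : (x - x') 0 i = x 0 i - x' 0 i by rewrite !mxE.
by apply: rV_ord0_lift => [|i]; rewrite subE ?vcons_0 ?vcons_lift ?subE.
Qed.

Lemma vconsP n (x : 'rV[R]_n.+1) : exists t y, x = vcons t y.
Proof.
exists (x 0 ord0), (\row_i x 0 (lift ord0 i)).
by apply: rV_ord0_lift => [|i]; rewrite ?vcons_0 ?vcons_lift ?mxE.
Qed.

Lemma l1norm0 n : l1norm (0 : 'rV[R]_n) = 0.
Proof. by rewrite /l1norm big1// => i _; rewrite mxE normr0. Qed.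

Lemma l1norm_ge0 n (x : 'rV[R]_n) : 0 <= l1norm x.
Proof. exact: sumr_ge0. Qed.

Lemma l1normN n (x : 'rV[R]_n) : l1norm (- x) = l1norm x.
Proof. by apply: eq_bigr => i _; rewrite mxE normrN. Qed.

Lemma l1normD n (x y : 'rV[R]_n) : l1norm (x + y) <= l1norm x + l1norm y.
Proof. by rewrite /l1norm -big_split/=; apply: ler_sum => i _; rewrite mxE ler_normD. Qed.

Lemma l1norm_mx_le n m (M : 'M[R]_(n, m)) :
  exists2 K, 0 <= K & forall x, l1norm (x *m M) <= K * l1norm x.
Proof.
pose k i : R := \sum_j `|M i j|.
have k0 i : 0 <= k i by exact: sumr_ge0.
exists (\sum_i k i) => [|x]; first exact: sumr_ge0.
rewrite /l1norm [leRHS]mulr_sumr.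
apply: (@le_trans _ _ (\sum_j \sum_i `|x 0 i| * `|M i j|)).
  apply: ler_sum => j _; rewrite mxE; apply: le_trans (ler_norm_sum _ _ _) _.
  by apply: ler_sum => i _; rewrite normrM.
rewrite exchange_big/=; apply: ler_sum => i _.
rewrite -mulr_sumr mulrC ler_wpM2r//.
by rewrite (bigD1 i)//= lerDl sumr_ge0.
Qed.

Fixpoint iterint n : ('rV[R]_n -> R) -> R :=
  match n with
  | 0 => fun g => g 0
  | m.+1 => fun g => \int[mu]_t iterint (fun y : 'rV[R]_m => g (vcons t y))
  end.


Lemma lipc_section (T : zmodType) (N : T -> R) n B C (G : T * 'rV[R]_n -> R) :
  N 0 = 0 -> (forall x, 0 <= N x) -> lipc (prodN N (@l1norm n)) B C G ->
  forall x, lipc (@l1norm n) B C (fun y => G (x, y)).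
Proof.
move=> N0 Nge0 Gl x.
apply: (@lipc_comp _ _ _ _ _ (fun y => (x, y)) B B C 1 G Gl) => // [y z|y].
  by rewrite /prodN/= subrr N0 add0r mul1r.
by rewrite /prodN/= => h; rewrite ltr_wpDl.
Qed.

Lemma lipc_vcons n B C (g : 'rV[R]_n.+1 -> R) : lipc (@l1norm n.+1) B C g ->
  lipc (prodN Num.norm (@l1norm n)) B C (fun z => g (vcons z.1 z.2)).
Proof.
move=> gl; apply: (@lipc_comp _ _ _ _ _ (fun z => vcons z.1 z.2) B B C 1 g gl) => //.
  by move=> y z; rewrite vconsB l1norm_vcons mul1r.
by move=> y; rewrite l1norm_vcons.
Qed.

Lemma eq_iterint n (g h : 'rV[R]_n -> R) : g =1 h -> iterint g = iterint h.
Proof. by move=> gh; congr iterint; apply/funext. Qed.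

Let ge0_norm (x : R) : 0 <= `|x|. Proof. exact: normr_ge0. Qed.

Let iterint_bounded n := forall B C g, 0 <= B -> lipc (@l1norm n) B C g ->
  0 <= iterint g <= C * (2 * B) ^+ n.

Let iterint_lip n := forall B C C' e g h, 0 <= B ->
  lipc (@l1norm n) B C g -> lipc (@l1norm n) B C' h ->
  (forall x, `|g x - h x| <= e) -> `|iterint g - iterint h| <= e * (2 * B) ^+ n.

Let lipc_iterint_aux n B C (T : zmodType) (N : T -> R) (G : T * 'rV[R]_n -> R) :
  iterint_bounded n -> iterint_lip n -> 0 <= B -> N 0 = 0 -> (forall x, 0 <= N x) ->
  lipc (prodN N (@l1norm n)) B C G ->
  lipc N B (C * (2 * B) ^+ n) (fun x => iterint (fun y => G (x, y))).
Proof.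
move=> h1 h2 B0 N0 Nge0 Gl.
have Gs := lipc_section N0 Nge0 Gl.
have [GB GC [L L0 GL]] := Gl.
split.
(* Beyond the support the section is identically zero, so it satisfies [lipc] with upper bound 0,
   and [iterint_bounded] forces its integral to vanish. *)
- move=> x Bx; suff h0 : lipc (@l1norm n) B 0 (fun y => G (x, y)).
    have := h1 _ _ _ B0 h0; rewrite mul0r => ?; apply/eqP; rewrite eq_le.
    by rewrite andbC.
  have [s1 s2 s3] := Gs x; split => // y.
  by rewrite GB ?lexx// /prodN/= ltr_wpDr// l1norm_ge0.
- by move=> x; exact: h1.
- exists (L * (2 * B) ^+ n) => [|x y]; first by rewrite mulr_ge0// exprn_ge0// mulr_ge0.
  rewrite mulrAC; apply: h2 (Gs x) (Gs y) _ => // z.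
  by apply: le_trans (GL _ _) _; rewrite /prodN/= subrr l1norm0 addr0.
Qed.

(** The two properties need a joint induction: the outer integral can be estimated only once the
    inner one is a bounded Lipschitz function of the first coordinate. *)
Let iterint_aux n : iterint_bounded n /\ iterint_lip n.
Proof.
elim: n => [|n [IH1 IH2]].
  split=> [B C g B0 [_ gC _]|B C C' e g h B0 _ _ gh]; rewrite expr0 mulr1//=.
have IH3 B C g : 0 <= B -> lipc (@l1norm n.+1) B C g ->
    lipc Num.norm B (C * (2 * B) ^+ n) (fun t => iterint (fun y => g (vcons t y))).
  move=> B0 /lipc_vcons gl.
  by have := lipc_iterint_aux IH1 IH2 B0 (normr0 _) ge0_norm gl.
split=> [B C g B0 gl|B C C' e g h B0 gl hl gh] /=.
  have fl := IH3 _ _ _ B0 gl; have [fB fC _] := fl.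
  apply/andP; split; first by apply: Rintegral_ge0 => t _; have /andP[] := fC t.
  rewrite exprSr mulrA; apply: le_trans (ler_norm _) _.
  apply: Rintegral_supp_bound => //; first exact: lipc_measurable fl.
  by move=> t; have /andP[? ?] := fC t; rewrite ger0_norm.
have fl := IH3 _ _ _ B0 gl; have [fB fC _] := fl.
have kl := IH3 _ _ _ B0 hl; have [kB kC _] := kl.
rewrite -RintegralB//; [|exact: lipc_integrable fl|exact: lipc_integrable kl].
rewrite exprSr mulrA; apply: Rintegral_supp_bound => //.
- by apply: measurable_funB; [exact: lipc_measurable fl|exact: lipc_measurable kl].
- move=> t; apply: (IH2 B C C') => //.
    exact: (lipc_section (normr0 _) ge0_norm (lipc_vcons gl) t).
  exact: (lipc_section (normr0 _) ge0_norm (lipc_vcons hl) t).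
- by move=> t Bt; rewrite fB// kB// subrr.
Qed.

Lemma iterint_bound n B C (g : 'rV[R]_n -> R) : 0 <= B -> lipc (@l1norm n) B C g ->
  0 <= iterint g <= C * (2 * B) ^+ n.
Proof. by have [h _] := iterint_aux n; exact: h. Qed.

Lemma lipc_iterint n B C (T : zmodType) (N : T -> R) (G : T * 'rV[R]_n -> R) :
  0 <= B -> N 0 = 0 -> (forall x, 0 <= N x) ->
  lipc (prodN N (@l1norm n)) B C G ->
  lipc N B (C * (2 * B) ^+ n) (fun x => iterint (fun y => G (x, y))).
Proof. by have [h1 h2] := iterint_aux n; exact: lipc_iterint_aux. Qed.

Lemma lipc_iterint_vcons n B C (g : 'rV[R]_n.+1 -> R) : 0 <= B ->
  lipc (@l1norm n.+1) B C g ->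
  lipc Num.norm B (C * (2 * B) ^+ n) (fun t => iterint (fun y => g (vcons t y))).
Proof.
by move=> B0 /lipc_vcons gl; have := lipc_iterint B0 (normr0 _) ge0_norm gl.
Qed.

Lemma lipc_vcons_section n B C (g : 'rV[R]_n.+1 -> R) t :
  lipc (@l1norm n.+1) B C g -> lipc (@l1norm n) B C (fun y => g (vcons t y)).
Proof. by move=> gl; exact: (lipc_section (normr0 _) ge0_norm (lipc_vcons gl) t). Qed.

Lemma iterintZ n B C c (g : 'rV[R]_n -> R) : 0 <= B -> lipc (@l1norm n) B C g ->
  iterint (fun x => c * g x) = c * iterint g.
Proof.
move=> B0; elim: n g => //= n IH g gl.
rewrite -RintegralZl//; last exact: lipc_integrable (lipc_iterint_vcons B0 gl).
congr (Rintegral _ _ _); apply/funext => t.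
by rewrite IH//; exact: lipc_vcons_section.
Qed.

Lemma iterint_subl n B C (g : 'rV[R]_n -> R) (v : 'rV[R]_n) : 0 <= B -> lipc (@l1norm n) B C g ->
  iterint (fun x => g (v - x)) = iterint g.
Proof.
move=> B0; elim: n g v => [|n IH] g v gl /=; first by congr g; apply/rowP => -[].
have [s [w ->]] := vconsP v.
rewrite -(Rintegral_subl s (lipc_iterint_vcons B0 gl)).
congr (Rintegral _ _ _); apply/funext => t.
rewrite -(IH _ w (lipc_vcons_section (s - t) gl)).
by apply: eq_iterint => y; rewrite vconsB.
Qed.

Lemma iterint_gt0 n B C (g : 'rV[R]_n -> R) x : 0 <= B -> lipc (@l1norm n) B C g ->
  0 < g x -> 0 < iterint g.
Proof.
move=> B0; elim: n g x => [|n IH] g x gl gx /=.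
  by rewrite (_ : 0 = x)//; apply/rowP => -[].
have [s [w xE]] := vconsP x; rewrite xE in gx.
apply: (Rintegral_gt0 (x := s) (lipc_iterint_vcons B0 gl)).
exact: (IH _ w (lipc_vcons_section s gl)).
Qed.

Lemma le_iterint n B C C' (g h : 'rV[R]_n -> R) : 0 <= B ->
  lipc (@l1norm n) B C g -> lipc (@l1norm n) B C' h -> (forall x, g x <= h x) ->
  iterint g <= iterint h.
Proof.
move=> B0; elim: n g h => [|n IH] g h gl hl gh //=.
apply: le_Rintegral => //.
- exact: lipc_integrable (lipc_iterint_vcons B0 gl).
- exact: lipc_integrable (lipc_iterint_vcons B0 hl).
- by move=> t _; apply: IH => //; exact: lipc_vcons_section.
Qed.

Let prodN0 (T1 T2 : zmodType) (N1 : T1 -> R) (N2 : T2 -> R) :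
  N1 0 = 0 -> N2 0 = 0 -> prodN N1 N2 0 = 0.
Proof. by move=> h1 h2; rewrite /prodN/= h1 h2 addr0. Qed.

Let prodN_ge0 (T1 T2 : zmodType) (N1 : T1 -> R) (N2 : T2 -> R) :
  (forall x, 0 <= N1 x) -> (forall x, 0 <= N2 x) -> forall z, 0 <= prodN N1 N2 z.
Proof. by move=> h1 h2 z; exact: addr_ge0. Qed.

(** Integrating out the last [n] coordinates leaves a Lipschitz function of two real variables, to
    which the planar Fubini theorem applies; the induction hypothesis then moves the integral past
    the others. *)
Lemma Rintegral_iterint_swap n B C (G : R * 'rV[R]_n -> R) : 0 <= B ->
  lipc (prodN Num.norm (@l1norm n)) B C G ->
  \int[mu]_t iterint (fun y => G (t, y)) = iterint (fun y => \int[mu]_t G (t, y)).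
Proof.
move=> B0; elim: n G => [|n IH] G Gl //=.
pose G' (z : (R * R) * 'rV[R]_n) := G (z.1.1, vcons z.1.2 z.2).
have G'l : lipc (prodN (prodN Num.norm Num.norm) (@l1norm n)) B C G'.
  apply: (@lipc_comp _ _ _ _ _ (fun z => (z.1.1, vcons z.1.2 z.2)) B B C 1 G Gl) => //.
    by move=> y z; rewrite /prodN/= vconsB l1norm_vcons mul1r addrA.
  by move=> y; rewrite /prodN/= l1norm_vcons addrA.
have Kl := lipc_iterint B0 (prodN0 (normr0 _) (normr0 _))
  (prodN_ge0 ge0_norm ge0_norm) G'l.
have := Rintegral_swap B0 Kl; rewrite /G'/= => ->.
congr (Rintegral _ _ _); apply/funext => s.
apply: (IH (fun z => G (z.1, vcons s z.2))).
apply: (@lipc_comp _ _ _ _ _ (fun z => (z.1, vcons s z.2)) B B C 1 G Gl) => //.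
  by move=> y z; rewrite /prodN/= vconsB l1norm_vcons subrr normr0 add0r mul1r.
by move=> y; rewrite /prodN/= l1norm_vcons => h; rewrite addrCA ltr_wpDl.
Qed.

Lemma iterint_swap m n B C (G : 'rV[R]_m * 'rV[R]_n -> R) : 0 <= B ->
  lipc (prodN (@l1norm m) (@l1norm n)) B C G ->
  iterint (fun x => iterint (fun y => G (x, y))) = iterint (fun y => iterint (fun x => G (x, y))).
Proof.
move=> B0; elim: m G => [|m IH] G Gl //=.
pose G' (z : (R * 'rV[R]_n) * 'rV[R]_m) := G (vcons z.1.1 z.2, z.1.2).
have G'l : lipc (prodN (prodN Num.norm (@l1norm n)) (@l1norm m)) B C G'.
  apply: (@lipc_comp _ _ _ _ _ (fun z => (vcons z.1.1 z.2, z.1.2)) B B C 1 G Gl) => //.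
    by move=> y z; rewrite /prodN/= vconsB l1norm_vcons mul1r addrAC.
  by move=> y; rewrite /prodN/= l1norm_vcons addrAC.
have Kl := lipc_iterint B0 (prodN0 (normr0 _) (@l1norm0 n))
  (prodN_ge0 ge0_norm (@l1norm_ge0 n)) G'l.
rewrite -(Rintegral_iterint_swap B0 Kl).
congr (Rintegral _ _ _); apply/funext => t.
apply: (IH (fun z => G (vcons t z.1, z.2))).
apply: (@lipc_comp _ _ _ _ _ (fun z => (vcons t z.1, z.2)) B B C 1 G Gl) => //.
  by move=> y z; rewrite /prodN/= vconsB l1norm_vcons subrr normr0 add0r mul1r.
by move=> y; rewrite /prodN/= l1norm_vcons => h; rewrite -addrA ltr_wpDl.
Qed.

End iterated.

(** * Orthogonal invariance *)

Section invariance.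
Context {R : realType}.
Notation mu := (@lebesgue_measure R).
Implicit Types (B C e t s : R) (n : nat).

Lemma lipc_widen (T : zmodType) (N : T -> R) B B' C g : B <= B' ->
  lipc N B C g -> lipc N B' C g.
Proof. by move=> BB' [gB gC gL]; split => // x Bx; apply: gB; exact: le_lt_trans Bx. Qed.

Lemma lipc_mulmx n (M M' : 'M[R]_n) B C : 0 <= B -> M *m M' = 1%:M ->
  exists2 B', B <= B' & forall g, lipc (@l1norm R n) B C g ->
    lipc (@l1norm R n) B' C (fun y => g (y *m M)).
Proof.
move=> B0 MM'; have [K K0 hK] := l1norm_mx_le M; have [K' K'0 hK'] := l1norm_mx_le M'.
exists ((K' + 1) * B) => [|g gl].
  by rewrite mulrDl mul1r lerDr mulr_ge0.
apply: (@lipc_comp _ _ _ _ _ (fun y => y *m M) B _ C K g gl) => // [x y|x].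
  by rewrite -mulmxBl.
move=> h; rewrite ltNge; apply/negP => h'.
have : l1norm x <= K' * l1norm (x *m M) by have := hK' (x *m M); rewrite -mulmxA MM' mulmx1.
have : K' * l1norm (x *m M) <= K' * B by rewrite ler_wpM2l.
have := B0; lra.
Qed.

Lemma iterint_subr n B C (g : 'rV[R]_n -> R) (v : 'rV[R]_n) : 0 <= B ->
  lipc (@l1norm R n) B C g -> iterint (fun x => g (x - v)) = iterint g.
Proof.
move=> B0 gl.
have gl' : lipc (@l1norm R n) B C (fun x => g (- x)).
  apply: (@lipc_comp _ _ _ _ _ (fun x => - x) B _ C 1 g gl) => // [x y|x].
    by rewrite mul1r -opprD l1normN.
  by rewrite l1normN.
have := iterint_subl v B0 gl'; under eq_iterint do rewrite opprB; move=> ->.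
by have := iterint_subl 0 B0 gl; under eq_iterint do rewrite sub0r.
Qed.

(** Justifies exchanging the integrals in the Haar argument. The inverse [M'] confines the second
    variable: [x] and [y *m M - x] bounded by [B] bound [y *m M] by [2 * B]. *)
Lemma lipc_convol n (M M' : 'M[R]_n) B C : 0 <= B -> M *m M' = 1%:M ->
  exists2 B', 0 <= B' & forall g h, lipc (@l1norm R n) B C g -> lipc (@l1norm R n) B C h ->
    lipc (prodN (@l1norm R n) (@l1norm R n)) B' (C * C)
      (fun z => g z.1 * h (z.2 *m M - z.1)).
Proof.
move=> B0 MM'; have [K K0 hK] := l1norm_mx_le M; have [K' K'0 hK'] := l1norm_mx_le M'.
exists (B + K' * (2 * B)) => [|g h [gB gC [L L0 gL]] [hB hC [L' L'0 hL]]].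
  by rewrite addr_ge0// mulr_ge0// mulr_ge0.
have C0 : 0 <= C by have /andP[] := gC 0; exact: le_trans.
split.
- move=> [x y]; rewrite /prodN/= => xy.
  have [Bx|xB] := ltP B (l1norm x); first by rewrite gB// mul0r.
  rewrite hB ?mulr0// ltNge; apply/negP => h'.
  have h1 : l1norm (y *m M) <= 2 * B.
    rewrite -(subrK x (y *m M)); apply: le_trans (l1normD _ _) _; lra.
  have : l1norm y <= K' * l1norm (y *m M) by have := hK' (y *m M); rewrite -mulmxA MM' mulmx1.
  have : K' * l1norm (y *m M) <= K' * (2 * B) by rewrite ler_wpM2l.
  lra.
- move=> [x y]/=; have /andP[g0 g1] := gC x; have /andP[h0 h1] := hC (y *m M - x).
  by rewrite mulr_ge0//= ler_pM.
- exists (L * C + C * (L' * (K + 1))).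
    by rewrite addr_ge0// ?mulr_ge0// addr_ge0.
  move=> [x y] [x' y']; rewrite /prodN/=.
  set a := l1norm (x - x'); set b := l1norm (y - y').
  have a0 : 0 <= a by exact: l1norm_ge0.
  have b0 : 0 <= b by exact: l1norm_ge0.
  have -> : g x * h (y *m M - x) - g x' * h (y' *m M - x') =
    (g x - g x') * h (y *m M - x) + g x' * (h (y *m M - x) - h (y' *m M - x')) by ring.
  apply: le_trans (ler_normD _ _) _; rewrite !normrM.
  have /andP[g0 g1] := gC x'; have /andP[h0 h1] := hC (y *m M - x).
  have e1 : `|g x - g x'| * `|h (y *m M - x)| <= L * a * C.
    by apply: ler_pM => //; rewrite ger0_norm.
  have e2 : l1norm (y *m M - x - (y' *m M - x')) <= K * b + a.
    have -> : y *m M - x - (y' *m M - x') = (y - y') *m M + - (x - x').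
      by rewrite mulmxBl !opprB !addrA; apply/rowP => i; rewrite !mxE; ring.
    by apply: le_trans (l1normD _ _) _; rewrite l1normN lerD2r.
  have e3 : `|g x'| * `|h (y *m M - x) - h (y' *m M - x')| <= C * (L' * (K * b + a)).
    apply: ler_pM => //; first by rewrite ger0_norm.
    by apply: le_trans (hL _ _) _; rewrite ler_wpM2l.
  have e4 : 0 <= C * L' by rewrite mulr_ge0.
  have e5 : 0 <= (L * C) * b by rewrite !mulr_ge0.
  have e6 : 0 <= (C * L') * (K * a + b) by rewrite mulr_ge0// addr_ge0// mulr_ge0.
  nra.
Qed.

(* Uniqueness of Haar measure: both sides are the double integral of
   [g x * h (y M - x)], which is symmetric in [g] and [h] after the
   substitution [x -> y M - x]. *)
Lemma iterint_mulmx_comm n (M M' : 'M[R]_n) B C g h : 0 <= B -> M *m M' = 1%:M ->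
  lipc (@l1norm R n) B C g -> lipc (@l1norm R n) B C h ->
  iterint g * iterint (fun y => h (y *m M)) = iterint h * iterint (fun y => g (y *m M)).
Proof.
move=> B0 MM' gl hl; have M'M := mulmx1C MM'.
have [B1 B01 cl] := lipc_convol C B0 MM'.
have [B2 B02 ml] := lipc_mulmx C B0 MM'.
have B2_0 := le_trans B0 B02.
pose A (g h : 'rV[R]_n -> R) := iterint (fun x => iterint (fun y => g x * h (y *m M - x))).
have AE k l : lipc (@l1norm R n) B C k -> lipc (@l1norm R n) B C l ->
    A k l = iterint k * iterint (fun y => l (y *m M)).
  move=> kl ll; rewrite mulrC -(iterintZ _ B0 kl); apply: eq_iterint => x.
  have ll' := ml _ ll; set l' := fun y => l (y *m M) in ll' *.
  (* The shift is moved inside the matrix, so that translation invariance removes it from the inner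
     integral. *)
  have lE y : l (y *m M - x) = l' (y - x *m M').
    by rewrite /l' mulmxBl -mulmxA M'M mulmx1.
  have sl : lipc (@l1norm R n) (B2 + l1norm (x *m M')) C (fun y => l' (y - x *m M')).
    apply: (@lipc_comp _ _ _ _ _ (fun y => y - x *m M') B2 _ C 1 l' ll') => // [y z|y].
      by rewrite mul1r opprB addrA subrK.
    move=> h1; have := l1normD (y - x *m M') (x *m M'); rewrite subrK; lra.
  under eq_iterint do rewrite lE.
  rewrite (iterintZ _ _ sl); last by rewrite addr_ge0// l1norm_ge0.
  by rewrite (iterint_subr _ B2_0 ll') mulrC.
rewrite -AE// -AE// /A (iterint_swap B01 (cl _ _ gl hl)) (iterint_swap B01 (cl _ _ hl gl)).
apply: eq_iterint => y /=.
have sl : lipc (@l1norm R n) B1 (C * C) (fun x => h x * g (y *m M - x)).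
  apply: (@lipc_comp _ _ _ _ _ (fun x => (x, y)) B1 B1 _ 1 _ (cl _ _ hl gl)) => //.
    by move=> x z; rewrite /prodN/= subrr l1norm0 addr0 mul1r.
  by move=> x h1; rewrite /prodN/= ltr_wpDr// l1norm_ge0.
rewrite -(iterint_subl (y *m M) B01 sl).
by apply: eq_iterint => x; rewrite subKr mulrC.
Qed.

Definition sqnorm n (x : 'rV[R]_n) : R := \sum_i x 0 i ^+ 2.

(** The radial test function: a truncated paraboloid, polynomial where it is positive, so that its
    Lipschitz bound is elementary. *)
Definition cap n (x : 'rV[R]_n) : R := Num.max 0 (1 - sqnorm x).

Lemma sqnormE n (x : 'rV[R]_n) : sqnorm x = (x *m x^T) 0 0.
Proof. by rewrite mxE; apply: eq_bigr => i _; rewrite mxE expr2. Qed.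

Lemma sqnorm_orth n (M : 'M[R]_n) x : M *m M^T = 1%:M -> sqnorm (x *m M) = sqnorm x.
Proof.
by move=> MM; rewrite !sqnormE trmx_mul mulmxA -(mulmxA x) MM mulmx1.
Qed.

Lemma sqr_le_sqnorm n (x : 'rV[R]_n) i : x 0 i ^+ 2 <= sqnorm x.
Proof. by rewrite /sqnorm (bigD1 i)//= lerDl sumr_ge0// => j _; exact: sqr_ge0. Qed.

Lemma lipc_cap n : lipc (@l1norm R n) n%:R 1 (@cap n).
Proof.
have abs1 (x : 'rV[R]_n) : sqnorm x < 1 -> forall i, `|x 0 i| <= 1.
  move=> x1 i; have := sqr_le_sqnorm x i.
  rewrite -real_normK ?num_real// => h.
  have := normr_ge0 (x 0 i); nra.
split.
- move=> x nx; rewrite /cap; case: (ltP (sqnorm x) 1) => [x1|x1]; last first.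
    by apply/max_idPl; rewrite subr_le0.
  suff : l1norm x <= n%:R by rewrite leNgt nx.
  apply: (@le_trans _ _ (\sum_(i < n) 1)).
    by apply: ler_sum => i _; exact: abs1.
  by rewrite sumr_const card_ord.
- move=> x; rewrite /cap le_max lexx/= ge_max ler01/= gerBl.
  by apply: sumr_ge0 => i _; exact: sqr_ge0.
(* With [cap y <= cap x] and [x] in the unit ball, either some coordinate of [y] exceeds 3 in
   absolute value and the points are more than 2 apart, or each difference of squares has slope at
   most [1 + 3]. *)
- exists 4 => // x y.
  wlog xy : x y / cap y <= cap x => [h|].
    have [/h//|/ltW/h] := leP (cap y) (cap x).
    by rewrite distrC -opprB l1normN.
  rewrite ger0_norm ?subr_ge0//.
  have y0 : 0 <= cap y by rewrite le_max lexx.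
  have [x1|x1] := leP 1 (sqnorm x).
    have x0 : cap x = 0 by apply/max_idPl; rewrite subr_le0.
    by have := l1norm_ge0 (x - y); rewrite x0; lra.
  have xE : cap x = 1 - sqnorm x by apply/max_idPr; rewrite subr_ge0 ltW.
  have s0 : 0 <= sqnorm x by apply: sumr_ge0 => i _; exact: sqr_ge0.
  case: (pselect (exists i, 3 < `|y 0 i|)) => [[i yi]|h].
    have h1 : `|x 0 i - y 0 i| <= l1norm (x - y).
      rewrite /l1norm (bigD1 i)//= !mxE lerDl.
      by apply: sumr_ge0 => j _; exact: normr_ge0.
    have h2 := abs1 x x1 i.
    have h3 : `|y 0 i| <= `|x 0 i| + `|x 0 i - y 0 i|.
      by rewrite -{1}[y 0 i](subKr (x 0 i)); exact: ler_normB.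
    lra.
  have h1 i : `|y 0 i| <= 3 by rewrite leNgt; apply/negP => h1; apply: h; exists i.
  have h2 : 1 - sqnorm y <= cap y by rewrite le_max lexx orbT.
  have h3 : sqnorm y - sqnorm x <= 4 * l1norm (x - y).
    rewrite /sqnorm /l1norm -sumrB mulr_sumr; apply: ler_sum => i _; rewrite !mxE.
    rewrite subr_sqr distrC; apply: le_trans (ler_norm _) _.
    rewrite normrM mulrC ler_wpM2r//; apply: le_trans (ler_normD _ _) _.
    by have := h1 i; have := abs1 x x1 i; lra.
  lra.
Qed.

Lemma iterint_orth n (M : 'M[R]_n) B C g : 0 <= B -> M *m M^T = 1%:M ->
  lipc (@l1norm R n) B C g -> iterint (fun y => g (y *m M)) = iterint g.
Proof.
move=> B0 MM gl.
(* Common support and height bounds for [g] and [cap], as the exchange lemma takes a single pair. *)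
pose D := Num.max B n%:R; pose E := Num.max C 1.
have D0 : 0 <= D by rewrite le_max B0.
have gl' : lipc (@l1norm R n) D E g.
  have [g1 g2 g3] := gl; split => // x.
    by rewrite gt_max => /andP[/g1].
  by have /andP[-> h] := g2 x; rewrite /= le_max h.
have bl : lipc (@l1norm R n) D E (@cap n).
  have [g1 g2 g3] := lipc_cap n; split => // x.
    by rewrite gt_max => /andP[_ /g1].
  by have /andP[-> h] := g2 x; rewrite /= le_max h orbT.
have := iterint_mulmx_comm D0 MM gl' bl.
have -> : iterint (fun y => cap (y *m M)) = iterint (@cap n).
  by apply: eq_iterint => y; rewrite /cap sqnorm_orth.
rewrite mulrC => /mulfI <- //; rewrite gt_eqF//.
apply: (iterint_gt0 (x := 0) D0 bl).
rewrite /cap /sqnorm big1 ?subr0 ?lt_max ?ltr01 ?orbT// => i _.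
by rewrite mxE expr0n.
Qed.

(** The bridge from functions to sets: finiteness, rotation invariance, positivity of volumes and
    measurability in the slicing variable are all obtained by passing to this limit. *)
Lemma cvg_lvol n (A : set 'rV[R]_n) (g : nat -> 'rV[R]_n -> R) B C : 0 <= B ->
  (forall k, lipc (@l1norm R n) B C (g k)) ->
  (forall x, g k x @[k --> \oo] --> (\1_A x : R)) ->
  (iterint (g k))%:E @[k --> \oo] --> lvol A.
Proof.
move=> B0; elim: n A g C => [|n IH] A g C gl gA /=.
  by apply: cvg_EFin; [exact: nearW|exact: gA].
have il k := lipc_iterint_vcons B0 (gl k).
pose D := C * (2 * B) ^+ n.
have C0 : 0 <= C by have [_ h _] := gl 0%N; have /andP[] := h 0; exact: le_trans.
have D0 : 0 <= D by rewrite mulr_ge0// exprn_ge0// mulr_ge0.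
have itvB : measurable (`[- B, B] : set R) by [].
have -> : (fun k => (\int[mu]_t iterint (fun y => g k (vcons t y)))%:E) =
    (fun k => \int[mu]_t (iterint (fun y => g k (vcons t y)))%:E)%E.
  apply/funext => k; rewrite /Rintegral fineK//.
  exact: integrable_fin_num (lipc_integrable measurableT (il k)).
apply: (@dominated_cvg _ (measurableTypeR R) R mu setT measurableT
  (fun k t => (iterint (fun y => g k (vcons t y)))%:E) _
  (fun t => (D * \1_(`[- B, B] : set R) t)%:E)) => //.
- by move=> k; apply/measurable_EFinP; exact: lipc_measurable (il k).
- move=> t _; apply: IH => [k|y]; first exact: lipc_vcons_section (gl k).
  exact: (gA (vcons t y)).
- apply: (@bounded_integrable _ setT _ B D) => //.
  + by apply: measurable_funM => //; exact: measurable_indic.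
  + move=> t; rewrite normrM ger0_norm// -[leRHS]mulr1 ler_wpM2l//.
    by rewrite indicE; case: (_ \in _); rewrite ?normr1 ?normr0.
  + move=> t Bt; rewrite indicE memNset ?mulr0//= in_itv/= -ler_norml.
    by apply/negP; rewrite -ltNge.
- move=> k t _; rewrite lee_fin; have [h1 h2 _] := il k.
  have /andP[h3 h4] := h2 t; rewrite ger0_norm// indicE.
  have [Bt|tB] := ltP B `|t|; first by rewrite h1// mulr_ge0.
  by rewrite mem_set ?mulr1//= in_itv/= -ler_norml.
Qed.

End invariance.

(** * Volumes of compact sets *)

Section approximation.
Context {R : realType}.
Notation mu := (@lebesgue_measure R).
Implicit Types (B C e t s : R) (n : nat).

Definition lip_approx n (A : set 'rV[R]_n) B (g : nat -> 'rV[R]_n -> R) :=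
  (forall k, lipc (@l1norm R n) B 1 (g k)) /\
  (forall x, g k x @[k --> \oo] --> (\1_A x : R)).

Lemma lip_approx_section n (A : set 'rV[R]_n.+1) B g t : lip_approx A B g ->
  lip_approx [set y | A (vcons t y)] B (fun k y => g k (vcons t y)).
Proof.
move=> [gl gA]; split => [k|y]; first exact: lipc_vcons_section.
exact: (gA (vcons t y)).
Qed.

Lemma lip_approx_bound n (A : set 'rV[R]_n) B g x : lip_approx A B g -> B < l1norm x -> ~ A x.
Proof.
move=> [gl gA] Bx Ax; have := gA x.
have -> : g ^~ x = fun=> 0 by apply/funext => k; have [h _ _] := gl k; rewrite h.
move=> h; have : (0 : R) = \1_A x.
  by apply: (cvg_unique (@Rhausdorff R) _ h); exact: cvg_cst.
by rewrite indicE mem_set//= => /eqP; rewrite eq_sym oner_eq0.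
Qed.

Lemma lvol_bound n (A : set 'rV[R]_n) B g : 0 <= B -> lip_approx A B g ->
  (0 <= lvol A <= ((2 * B) ^+ n)%:E)%E.
Proof.
move=> B0 [gl gA]; have cv := cvg_lvol B0 gl gA.
have h k : 0 <= iterint (g k) <= (2 * B) ^+ n by rewrite -(mul1r (_ ^+ n)); exact: (iterint_bound B0 (gl k)).
apply/andP; split.
  apply: (cvge_to_ge cv); apply: nearW => k; rewrite lee_fin.
  by have /andP[] := h k.
apply: (cvge_to_le cv); apply: nearW => k; rewrite lee_fin.
by have /andP[] := h k.
Qed.

Lemma lvol_fin_num n (A : set 'rV[R]_n) B g : 0 <= B -> lip_approx A B g ->
  lvol A \is a fin_num.
Proof.
move=> B0 gA; have /andP[h1 h2] := lvol_bound B0 gA.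
by rewrite ge0_fin_numE// (le_lt_trans h2)// ltry.
Qed.

Lemma lvol_mulmx n (M : 'M[R]_n) (A : set 'rV[R]_n) B g : 0 <= B ->
  M *m M^T = 1%:M -> lip_approx A B g -> lvol [set x | A (x *m M)] = lvol A.
Proof.
move=> B0 MM [gl gA]; have [B' BB' h] := lipc_mulmx 1 B0 MM.
have h1 := cvg_lvol B0 gl gA.
have h2 : (iterint (fun x => g k (x *m M)))%:E @[k --> \oo] --> lvol [set x | A (x *m M)].
  apply: (cvg_lvol (le_trans B0 BB') (fun k => h _ (gl k))) => x.
  exact: (gA (x *m M)).
apply: (cvg_unique (@ereal_hausdorff R) h2) => /=.
rewrite (_ : (fun k => _) = (fun k => (iterint (g k))%:E))//; apply/funext => k.
by rewrite (iterint_orth B0 MM (gl k)).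
Qed.

Lemma lip_approx_mulmx n (M : 'M[R]_n) (A : set 'rV[R]_n) B g : 0 <= B ->
  M *m M^T = 1%:M -> lip_approx A B g ->
  exists2 B', 0 <= B' & lip_approx [set x | A (x *m M)] B' (fun k x => g k (x *m M)).
Proof.
move=> B0 MM [gl gA]; have [B' BB' h] := lipc_mulmx 1 B0 MM.
exists B'; first exact: le_trans BB'.
by split => [k|x]; [exact: h|exact: (gA (x *m M))].
Qed.

Lemma max0_onem_lip (a b : R) :
  `|Num.max 0 (1 - a) - Num.max 0 (1 - b)| <= `|a - b|.
Proof.
have h1 := ler_norm (a - b).
have h2 : b - a <= `|a - b| by rewrite distrC ler_norm.
rewrite ler_norml !maxEle; apply/andP.
by case: (leP 0 (1 - a)) => h3; case: (leP 0 (1 - b)) => h4; split; lra.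
Qed.

Lemma sep_lip_approx n (A : set 'rV[R]_n) B : 0 <= B ->
  (forall x, A x -> l1norm x <= B) ->
  (forall x, ~ A x -> exists2 e, 0 < e & forall y, A y -> e <= l1norm (x - y)) ->
  exists2 g, lip_approx A (B + 1) g & forall k x, (\1_A x : R) <= g k x.
Proof.
(* The empty set is treated apart: an infimum over it is a default value and measures no
   distance. *)
move=> B0 AB Asep; have [A0|/set0P[z Az]] := eqVneq A set0.
  exists (fun _ _ => 0); last by move=> k x; rewrite A0 indicE in_set0.
  split => [k|x]; last by rewrite A0 indicE in_set0; exact: cvg_cst.
  split => [//|x|]; first by rewrite lexx ler01.
  by exists 0 => // x y; rewrite subrr normr0 mul0r.
pose S x := [set l1norm (x - y) | y in A].
pose dist x := inf (S x).
have S0 x : S x !=set0 by exists (l1norm (x - z)), z.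
have Slb x : has_lbound (S x) by exists 0 => _ [y _ <-]; exact: l1norm_ge0.
have dist_le x y : A y -> dist x <= l1norm (x - y).
  by move=> Ay; apply: ge_inf => //; exists y.
have dist_ge x e : (forall y, A y -> e <= l1norm (x - y)) -> e <= dist x.
  by move=> h; apply: lb_le_inf => // _ [y Ay <-]; exact: h.
have dist0 x : 0 <= dist x by apply: dist_ge => y _; exact: l1norm_ge0.
have distA x : A x -> dist x = 0.
  move=> Ax; apply/eqP; rewrite eq_le dist0 andbT.
  by have := dist_le x x Ax; rewrite subrr l1norm0.
have dist_lip x y : dist x <= dist y + l1norm (x - y).
  rewrite -lerBlDr; apply: dist_ge => u Au.
  have := dist_le x u Au; have := l1normD (x - y) (y - u).
  by rewrite addrA subrK; lra.
have distL x y : `|dist x - dist y| <= l1norm (x - y).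
  rewrite ler_norml; apply/andP; split; last by have := dist_lip x y; lra.
  by have := dist_lip y x; rewrite -opprB l1normN; lra.
(* The slope is at least 1 already for [k = 0], so each [g k] vanishes at distance 1 from [A],
   whence the radius [B + 1]. *)
pose g (k : nat) x := Num.max 0 (1 - k.+1%:R * dist x).
exists g; last first.
  move=> k x; rewrite indicE; case: (boolP (x \in A)) => [/set_mem/distA dx|_].
    by rewrite /g dx mulr0 subr0 le_max lexx orbT.
  by rewrite /g le_max lexx.
split => [k|x]; first split.
- move=> x Bx; apply/max_idPl; rewrite subr_le0.
  have h : 1 <= dist x.
    apply: dist_ge => y Ay; have := AB y Ay; have := l1normD (x - y) y.
    by rewrite subrK; lra.
  by rewrite -[leLHS]mulr1 ler_pM// ler1n.
- by move=> x; rewrite /g le_max lexx/= ge_max ler01/= gerBl mulr_ge0.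
- exists k.+1%:R => // x y; rewrite /g.
  apply: le_trans (_ : k.+1%:R * `|dist x - dist y| <= _); last by rewrite ler_wpM2l.
  set a := k.+1%:R * dist x; set b := k.+1%:R * dist y.
  have -> : k.+1%:R * `|dist x - dist y| = `|a - b|.
    by rewrite -mulrBr normrM ger0_norm.
  exact: max0_onem_lip.
rewrite indicE; case: (boolP (x \in A)) => [/set_mem/distA dx|/negP xA].
  rewrite /g dx; under eq_fun do rewrite mulr0 subr0.
  by rewrite (_ : Num.max 0 1 = 1) ?max_r//; exact: cvg_cst.
have [e e0 he] := Asep x (fun Ax => xA (mem_set Ax)).
have de := dist_ge x e he.
apply: cvg_near_cst; near=> k; apply/max_idPl; rewrite subr_le0.
apply: (@le_trans _ _ (k.+1%:R * e)); last by rewrite ler_wpM2l.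
rewrite -ler_pdivrMr// mul1r.
apply: (@le_trans _ _ k%:R); last by rewrite ler_nat.
near: k; exact: nbhs_infty_ger.
Unshelve. all: by end_near. Qed.

Lemma le_l1norm_coord n (x : 'rV[R]_n) i : `|x 0 i| <= l1norm x.
Proof. by rewrite /l1norm (bigD1 i)//= lerDl sumr_ge0. Qed.

(** The topology of row vectors comes from the maximum norm; this comparison and the next carry
    closedness and boundedness over to [l1norm]. *)
Lemma mxnorm_le_l1norm n (x : 'rV[R]_n) : `|x| <= l1norm x.
Proof.
rewrite (_ : `|x| = mx_norm x)// mx_normrE; apply: bigmax_le; first exact: l1norm_ge0.
by move=> [i j] _ /=; rewrite ord1; exact: le_l1norm_coord.
Qed.

Lemma l1norm_le_mxnorm n (x : 'rV[R]_n) : l1norm x <= n%:R * `|x|.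
Proof.
have -> : n%:R * `|x| = \sum_(i < n) `|x| by rewrite sumr_const card_ord mulr_natl.
apply: ler_sum => i _; rewrite (_ : `|x| = mx_norm x)// mx_normrE.
by apply: (le_bigmax _ (fun ij : 'I_1 * 'I_n => `|x ij.1 ij.2|) (0, i)).
Qed.

Lemma compact_bounded_l1norm n (K : set 'rV[R]_n) : compact K ->
  exists2 B, 0 <= B & forall x, K x -> l1norm x <= B.
Proof.
move=> /compact_bounded[M [_ hM]].
exists (n%:R * (`|M| + 1)) => [|x Kx]; first by rewrite mulr_ge0// addr_ge0.
apply: le_trans (l1norm_le_mxnorm x) _; rewrite ler_wpM2l//.
by apply: hM => //; rewrite (le_lt_trans (ler_norm M))// ltrDl.
Qed.

Lemma closed_sep n (K : set 'rV[R]_n) x : closed K -> ~ K x ->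
  exists2 e, 0 < e & forall y, K y -> e <= l1norm (x - y).
Proof.
move=> cK Kx; have : nbhs x (~` K).
  by apply: open_nbhs_nbhs; split => //; rewrite openC.
move=> /nbhs_ballP[e /= e0 h]; exists e => // y Ky; rewrite leNgt; apply/negP => xy.
apply: (h y) => //; rewrite -ball_normE/=.
exact: le_lt_trans (mxnorm_le_l1norm _) xy.
Qed.

End approximation.

(** * The one-dimensional inequality *)

Section one_dim_grunbaum.
Context {R : realType}.
Notation mu := (@lebesgue_measure R).
Implicit Types (a b p r s t x y z : R) (f : R -> R).

Lemma withinZ (c : R) (F : R -> R) a b : {within `[a, b], continuous F} ->
  {within `[a, b], continuous (fun x => c * F x)}.
Proof. by move=> cF x; apply: cvgM; [exact: cvg_cst|exact: cF]. Qed.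

(** Dividing [f] by its total mass reduces to [W b = 1]; the weight [f ^ r] is then multiplied by a
    constant, which preserves [P a = P b]. *)
Lemma powered_grunbaum a b p r f (W Z P : R -> R) : a < b -> 0 < p -> 0 <= r ->
  (forall x, a < x -> x < b -> 0 < f x) -> concave_oo (fun x => f x `^ p) a b ->
  (forall x, a < x -> x < b -> is_derive x 1 W (f x)) ->
  (forall x, a < x -> x < b -> is_derive x 1 Z (f x `^ r)) ->
  (forall x, a < x -> x < b -> is_derive x 1 P (x * f x `^ r)) ->
  {within `[a, b], continuous W} -> {within `[a, b], continuous Z} ->
  {within `[a, b], continuous P} -> W a = 0 -> 0 < W b -> P a = P b ->
  (1 <= r -> ((p + 1) / (2 * p + r)) `^ ((p + 1) / p) <= W 0 / W b) /\
  (r <= 1 -> ((p + r) / (2 * p + r)) `^ ((p + 1) / p) <= W 0 / W b).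
Proof.
move=> ab p0 r0 f_gt0 fconc W' Z' P' cW cZ cP Wa Wb Pab.
pose c := (W b)^-1; have c0 : 0 < c by rewrite invr_gt0.
pose k := c `^ r.
have g_gt0 x : a < x -> x < b -> 0 < c * f x.
  by move=> ax xb; rewrite mulr_gt0// f_gt0.
have gE e x : a < x -> x < b -> (c * f x) `^ e = c `^ e * f x `^ e.
  by move=> ax xb; rewrite powRM// ltW// f_gt0.
have gconc : concave_oo (fun x => (c * f x) `^ p) a b.
  move=> x y z ax xz zy yb; have az := lt_trans ax xz; have zb := lt_trans zy yb.
  have ay := lt_trans az zy; have xb := lt_trans xz zb.
  rewrite !gE//.
  rewrite -!mulrA -mulrDr ler_pM2l ?powR_gt0//; exact: fconc.
have gW' x : a < x -> x < b -> is_derive x 1 (fun x => c * W x) (c * f x).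
  by move=> ax xb; exact: is_deriveZ (W' x ax xb).
have gZ' x : a < x -> x < b -> is_derive x 1 (fun x => k * Z x) ((c * f x) `^ r).
  by move=> ax xb; rewrite gE//; exact: is_deriveZ (Z' x ax xb).
have gP' x : a < x -> x < b -> is_derive x 1 (fun x => k * P x) (x * (c * f x) `^ r).
  by move=> ax xb; rewrite gE// mulrCA; exact: is_deriveZ (P' x ax xb).
have gWa : c * W a = 0 by rewrite Wa mulr0.
have gWb : c * W b = 1 by rewrite mulVf// gt_eqF.
have gPab : k * P a = k * P b by rewrite Pab.
rewrite [W 0 / W b]mulrC; split => r1.
  exact: (powered_grunbaum_ge1 ab p0 r0 g_gt0 gconc gW' gZ' gP' (withinZ cW)
    (withinZ cZ) (withinZ cP) gWa gWb gPab r1).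
exact: (powered_grunbaum_le1 ab p0 r0 g_gt0 gconc gW' gZ' gP' (withinZ cW)
    (withinZ cZ) (withinZ cP) gWa gWb gPab r1).
Qed.

Lemma concave_oo_continuous G a b : concave_oo G a b ->
  (forall x, a < x -> x < b -> 0 <= G x) ->
  forall x, a < x -> x < b -> {for x, continuous G}.
Proof.
move=> cG G0 x ax xb.
pose d := Num.min (x - a) (b - x) / 2.
have m0 : 0 < Num.min (x - a) (b - x) by rewrite lt_min !subr_gt0 ax.
have d0 : 0 < d by rewrite divr_gt0.
have dm : d < Num.min (x - a) (b - x) by rewrite /d ltr_pdivrMr// mulr2n mulrDr mulr1 ltrDl.
have [ad db] : a < x - d /\ x + d < b by move: dm; rewrite lt_min => /andP[]; split; lra.
have Gl : 0 <= G (x - d) by apply: G0; lra.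
have Gr : 0 <= G (x + d) by apply: G0; lra.
have Gx : 0 <= G x by apply: G0.
(* Chords ending at [x - d] and [x + d], whose nonnegative end values are dropped, leave a Lipschitz
   estimate at [x] with constant [G x / d]. *)
have est t : `|x - t| < d -> `|G x - G t| * d <= G x * `|x - t|.
  rewrite ltr_norml => /andP[h1 h2].
  have nd : `|G x - G t| * d = `|(G x - G t) * d| by rewrite normrM (gtr0_norm d0).
  case: (ltgtP t x) => [tx|xt|->]; last by rewrite !subrr !normr0 mul0r mulr0.
    have h3 := cG (x - d) x t ltac:(lra) ltac:(lra) tx xb.
    have h4 := cG t (x + d) x ltac:(lra) tx ltac:(lra) db.
    rewrite [`|x - t|]ger0_norm ?subr_ge0 ?(ltW tx)//.
    have h5 : 0 <= G (x - d) * (x - t) by rewrite mulr_ge0// subr_ge0 ltW.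
    have h6 : 0 <= G (x + d) * (x - t) by rewrite mulr_ge0// subr_ge0 ltW.
    rewrite nd ler_norml; apply/andP; split; lra.
  have h3 := cG x (x + d) t ax xt ltac:(lra) db.
  have h4 := cG (x - d) t x ad ltac:(lra) xt ltac:(lra).
  rewrite [`|x - t|]ltr0_norm ?subr_lt0//.
  have h5 : 0 <= G (x - d) * (t - x) by rewrite mulr_ge0// subr_ge0 ltW.
  have h6 : 0 <= G (x + d) * (t - x) by rewrite mulr_ge0// subr_ge0 ltW.
  rewrite nd ler_norml; apply/andP; split; lra.
apply/cvgrPdist_le => e e0; near=> t.
have td : `|x - t| < d by near: t; apply: cvgr_dist_lt => //; exact: cvg_id.
rewrite -(ler_pM2r d0); apply: le_trans (est t td) _.
apply: (@le_trans _ _ ((G x + 1) * `|x - t|)); first by rewrite ler_wpM2r// lerDl.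
rewrite mulrC -ler_pdivlMr ?ltr_wpDl//.
near: t; apply: cvgr_dist_le; first exact: cvg_id.
by rewrite divr_gt0 ?ltr_wpDl// mulr_gt0.
Unshelve. all: by end_near. Qed.

Lemma convex_combination x y z : x < z -> z < y ->
  exists l, [/\ 0 < l < 1, l * (y - x) = z - x & (1 - l) * x + l * y = z].
Proof.
move=> xz zy; have xy := lt_trans xz zy; have yx : 0 < y - x by rewrite subr_gt0.
have lE : (z - x) / (y - x) * (y - x) = z - x by rewrite divfK// gt_eqF.
exists ((z - x) / (y - x)); split => //; last by have := lE; lra.
by rewrite divr_gt0 ?subr_gt0//= ltr_pdivrMr// mul1r ltrD2r.
Qed.

Lemma p_concave_conc f p a b : 0 < p -> p_concave p f ->
  (forall x, a < x -> x < b -> 0 < f x) -> concave_oo (fun x => f x `^ p) a b.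
Proof.
move=> p0 [f0 fc] f_gt0 x y z ax xz zy yb.
have xy := lt_trans xz zy.
have fx := f_gt0 x ax (lt_trans xy yb); have fy := f_gt0 y (lt_trans ax xy) yb.
have yx : 0 < y - x by rewrite subr_gt0.
have [l [l01 lE zE]] := convex_combination xz zy.
have := fc x y l (mulr_gt0 fx fy) l01; rewrite zE => h.
have s0 : 0 <= (1 - l) * f x `^ p + l * f y `^ p.
  have /andP[l0 l1] := l01.
  by rewrite addr_ge0// mulr_ge0 ?powR_ge0 ?subr_ge0// ltW.
have : (1 - l) * f x `^ p + l * f y `^ p <= f z `^ p.
  rewrite -[leLHS](powRr1 s0) -[X in _ `^ X <= _](mulVf (lt0r_neq0 p0)) powRrM.
  by apply: ge0_ler_powR; rewrite ?nnegrE ?powR_ge0 ?f0 ?(ltW p0).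
move=> h1.
have -> : y - z = (1 - l) * (y - x) by have := lE; lra.
rewrite -lE.
rewrite [leLHS](_ : _ = ((1 - l) * f x `^ p + l * f y `^ p) * (y - x)); last by ring.
by rewrite ler_pM2r.
Qed.

Lemma prim_is_derive (g : R -> R) a b x : mu.-integrable `[a, b] (EFin \o g) ->
  a < x -> x < b -> {for x, continuous g} ->
  is_derive x 1 (fun y => \int[mu]_(t in `[a, y]) g t) (g x).
Proof.
move=> gi ax xb gx; have [h1 h2] := continuous_FTC1_closed xb gi ax gx.
split; first exact: h1.
rewrite -derive1E; exact: h2.
Qed.

Lemma prim_within (g : R -> R) a b : a <= b -> mu.-integrable `[a, b] (EFin \o g) ->
  {within `[a, b], continuous (fun y => \int[mu]_(t in `[a, y]) g t)}.
Proof. exact: parameterized_integral_continuous. Qed.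

Lemma bounded_integrable_itv (g : R -> R) a b C : measurable_fun setT g ->
  (forall t, a <= t -> t <= b -> `|g t| <= C) -> mu.-integrable `[a, b] (EFin \o g).
Proof.
move=> mg gC; apply: measurable_bounded_integrable => //=.
- by rewrite lebesgue_measure_itv/=; case: ifP => _ //; rewrite -EFinD ltry.
- exact: measurable_funS mg.
- exists C; split; first exact: num_real.
  move=> x Cx t /=; rewrite in_itv/= => /andP[h1 h2].
  exact: le_trans (gC t h1 h2) (ltW Cx).
Qed.

Lemma p_concave_grunbaum f p r (B D : R) : 0 <= r -> 0 < p -> p_concave p f ->
  measurable_fun setT f -> (forall t, f t <= D) -> (forall t, B < `|t| -> f t = 0) ->
  0 < \int[mu]_t f t -> powered_centroid r f = 0 ->
  (1 <= r -> ((p + 1) / (2 * p + r)) `^ ((p + 1) / p) <=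
     \int[mu]_(t in `]-oo, 0]) f t / \int[mu]_t f t) /\
  (r <= 1 -> ((p + r) / (2 * p + r)) `^ ((p + 1) / p) <=
     \int[mu]_(t in `]-oo, 0]) f t / \int[mu]_t f t).
Proof.
move=> r0 p0 fconc mf fD fB If0 cen; have [f_ge0 fc] := fconc.
pose S := [set t | 0 < f t].
have notS t : ~ S t -> f t = 0.
  by move=> h; apply/eqP; rewrite eq_le f_ge0 andbT leNgt; apply/negP.
have Sconv x y z : S x -> S y -> x < z -> z < y -> S z.
  move=> Sx Sy xz zy.
  have [l [l01 lE zE]] := convex_combination xz zy.
  have := fc x y l (mulr_gt0 Sx Sy) l01; rewrite zE; apply: lt_le_trans.
  have /andP[l0 l1] := l01.
  by rewrite powR_gt0// addr_gt0// mulr_gt0 ?powR_gt0 ?subr_gt0.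
have SB t : S t -> `|t| <= B.
  by move=> St; rewrite leNgt; apply/negP => /fB ft; move: St; rewrite /S/= ft ltxx.
have Sn0 : S !=set0.
  apply: contrapT => h; move: If0.
  rewrite -(@supp_Rintegral _ set0) ?Rintegral_set0 ?ltxx// => t _.
  by apply: notS => St; apply: h; exists t.
have Sub : has_ubound S by exists B => t /SB; rewrite ler_norml => /andP[].
have Slb : has_lbound S by exists (- B) => t /SB; rewrite ler_norml => /andP[].
pose a := inf S; pose b := sup S.
have Sab t : S t -> a <= t <= b by move=> St; rewrite ge_inf//= ub_le_sup.
have f0 t : ~ `[a, b]%classic t -> f t = 0.
  by move=> h; apply: notS => /Sab; rewrite /= in_itv/= in h.
have ab : a < b.
  (* Otherwise [f] would vanish off a single point and have integral 0. *)
  rewrite ltNge; apply/negP => ba; move: If0.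
  rewrite -(@supp_Rintegral _ [set a]) ?Rintegral_set1 ?ltxx// => t ta.
  by apply: notS => /Sab/andP[h1 h2]; apply: ta => /=; apply/eqP; rewrite eq_le h1 (le_trans h2).
have f_gt0 x : a < x -> x < b -> 0 < f x.
  move=> ax xb.
  have [s Ss sx] := inf_lt Sn0 ax.
  have [t St xt] := sup_gt Sn0 xb.
  exact: (Sconv s t).
have fcc := p_concave_conc p0 fconc f_gt0.
have f_cont x : a < x -> x < b -> {for x, continuous f}.
  move=> ax xb.
  have fpK : (fun t => (f t `^ p) `^ p^-1) = f.
    by apply/funext => t; rewrite -powRrM mulfV ?gt_eqF// powRr1.
  rewrite -fpK; apply: cvg_powR; first by rewrite powR_gt0// f_gt0.
  apply: (concave_oo_continuous fcc _ ax xb) => y _ _; exact: powR_ge0.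
have fr_cont x : a < x -> x < b -> {for x, continuous (fun t => f t `^ r)}.
  by move=> ax xb; apply: cvg_powR; [exact: f_gt0|exact: f_cont].
have tfr_cont x : a < x -> x < b -> {for x, continuous (fun t => t * f t `^ r)}.
  by move=> ax xb; apply: cvgM; [exact: cvg_id|exact: fr_cont].
have mfr : measurable_fun setT (fun t => f t `^ r).
  by apply: (measurableT_comp (measurable_powR r)).
have mtfr : measurable_fun setT (fun t => t * f t `^ r).
  by apply: measurable_funM => //; exact: measurable_id.
have D0 : 0 <= D by exact: le_trans (f_ge0 0) (fD 0).
have frD t : `|f t `^ r| <= D `^ r.
  by rewrite ger0_norm ?powR_ge0//; apply: ge0_ler_powR; rewrite ?nnegrE ?f_ge0.
have fi : mu.-integrable `[a, b] (EFin \o f).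
  by apply: (bounded_integrable_itv (C := D)) => // t _ _; rewrite ger0_norm.
have fri : mu.-integrable `[a, b] (EFin \o (fun t => f t `^ r)).
  by apply: (bounded_integrable_itv (C := D `^ r)).
have tfri : mu.-integrable `[a, b] (EFin \o (fun t => t * f t `^ r)).
  apply: (bounded_integrable_itv (C := (`|a| + `|b|) * D `^ r)) => // t at_ tb.
  rewrite normrM ler_pM// ler_norml; apply/andP; split.
    by have := ler_norm (- a); rewrite normrN; have := normr_ge0 b; lra.
  by have := ler_norm b; have := normr_ge0 a; lra.
pose W x := \int[mu]_(t in `[a, x]) f t.
pose Z x := \int[mu]_(t in `[a, x]) f t `^ r.
pose P x := \int[mu]_(t in `[a, x]) (t * f t `^ r).
have W' x (ax : a < x) (xb : x < b) := prim_is_derive fi ax xb (f_cont x ax xb).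
have Z' x (ax : a < x) (xb : x < b) := prim_is_derive fri ax xb (fr_cont x ax xb).
have P' x (ax : a < x) (xb : x < b) := prim_is_derive tfri ax xb (tfr_cont x ax xb).
have cW := prim_within (ltW ab) fi.
have cZ := prim_within (ltW ab) fri.
have cP := prim_within (ltW ab) tfri.
have int_aa g : \int[mu]_(t in `[a, a]) g t = 0 by rewrite set_itv1 Rintegral_set1.
have Wb : W b = \int[mu]_t f t by exact: supp_Rintegral.
have Zb : 0 < Z b.
  have [c [ac cb h]] := MVT_oo ab cZ Z'.
  by move: h; rewrite int_aa subr0 /Z => ->; rewrite mulr_gt0 ?subr_gt0 ?powR_gt0 ?f_gt0.
have Pab : P a = P b.
  rewrite [LHS]int_aa; apply/esym; have [r_eq0|r_neq0] := eqVneq r 0.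
    move: cen; rewrite /powered_centroid r_eq0 eqxx -/S -/a -/b => abE.
    (* For [r = 0] the integrand of [P] is [t], because [f ^ 0] is 1 everywhere; so [P] is
       [x ^ 2 / 2] up to a constant, and the midpoint condition [b = - a] equates its end values. *)
    pose F x := P x - 2^-1 * (x * x).
    have F' x : a < x -> x < b -> is_derive x 1 F 0.
      move=> ax xb; have hx := is_derive_id x (1 : R).
      have h := is_deriveB (P' x ax xb) (is_deriveZ 2^-1 (is_deriveM hx hx)).
      apply: (is_derive_eq h); rewrite r_eq0 powRr0 /GRing.scale/=; lra.
    have cF : {within `[a, b], continuous F}.
      move=> x; apply: cvgB; first exact: cP.
      apply: (@continuous_subspaceT _ _ _ (fun x : R => 2^-1 * (x * x))) => y.
      by apply: cvgM; [exact: cvg_cst|apply: cvgM; exact: cvg_id].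
    have [c [_ _]] := MVT_oo ab cF F'.
    rewrite mul0r /F [P a]int_aa => h.
    have ba : b = - a by move: abE; lra.
    by move: h; rewrite ba mulrNN; lra.
  have r_gt0 : 0 < r by rewrite lt_def r_neq0.
  (* A positive [r] is essential, since [0 ^ 0 = 1]; it lets the integrals over the line be
     restricted to the support. *)
  have fr0 t : ~ `[a, b]%classic t -> f t `^ r = 0.
    by move=> /f0 ->; rewrite powR0.
  move: cen; rewrite /powered_centroid (negbTE r_neq0).
  rewrite -(@supp_Rintegral _ `[a, b] (fun t => f t `^ r))//.
  rewrite -(@supp_Rintegral _ `[a, b] (fun t => t * f t `^ r)); last first.
    by move=> t /fr0 ->; rewrite mulr0.
  (* The quotient vanishes through its numerator: [Zb] excludes division by 0, whose default value
     is also 0. *)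
  by move=> /eqP; rewrite mulf_eq0 invr_eq0 (gt_eqF Zb) orbF => /eqP.
have W0 : \int[mu]_(t in `]-oo, 0]) f t = W 0.
  rewrite /W [LHS]Rintegral_mkcond [RHS]Rintegral_mkcond.
  congr (Rintegral _ _ _); apply/funext => t; rewrite !patchE.
  case: ifPn => h1; case: ifPn => h2 //.
    apply: f0 => /=; rewrite in_itv/= => /andP[at_ _]; move/negP: h2; apply.
    by move: h1; rewrite !inE/= !in_itv/= at_.
  by exfalso; move/negP: h1; apply; move: h2; rewrite !inE/= !in_itv/= => /andP[].
rewrite W0 -Wb; have Wb0 : 0 < W b by rewrite Wb.
exact: (powered_grunbaum ab p0 r0 f_gt0 fcc W' Z' P' cW cZ cP (int_aa f) Wb0 Pab).
Qed.

End one_dim_grunbaum.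

(** * Slicing *)

Section slicing.
Context {R : realType}.
Notation mu := (@lebesgue_measure R).
Implicit Types (n : nat) (B t : R).

Lemma compact_lip_approx n (K : set 'rV[R]_n) : compact K ->
  exists B g, [/\ 0 <= B, lip_approx K B g & forall k x, (\1_K x : R) <= g k x].
Proof.
move=> cK; have [B B0 KB] := compact_bounded_l1norm cK.
have clK : closed K by apply: compact_closed => //; exact: norm_hausdorff.
have [g gK Kg] := sep_lip_approx B0 KB (fun x => closed_sep clK).
by exists (B + 1), g; split => //; rewrite addr_ge0.
Qed.

Lemma measurable_lvol_section n (A : set 'rV[R]_n.+1) B g : 0 <= B -> lip_approx A B g ->
  measurable_fun setT (fun t => lvol [set y | A (vcons t y)]).
Proof.
move=> B0 gA; have [gl _] := gA.
apply: (emeasurable_fun_cvg (fun k t => (iterint (fun y => g k (vcons t y)))%:E)).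
  by move=> k; apply/measurable_EFinP; exact: lipc_measurable (lipc_iterint_vcons B0 (gl k)).
move=> t _; have [gl' gA'] := lip_approx_section t gA.
exact: (cvg_lvol B0 gl' gA').
Qed.

(** A tent over a small ball inside [K] lies below the indicator of [K], hence below every [g k];
    its positive integral is a lower bound that survives the limit. *)
Lemma lvol_gt0 n (K : set 'rV[R]_n) B g : 0 <= B -> lip_approx K B g ->
  (forall k x, (\1_K x : R) <= g k x) -> interior K !=set0 -> (0 < lvol K)%E.
Proof.
move=> B0 [gl gK] Kg [x0 /nbhs_ballP[e /= e0 eK]].
pose T x := Num.max 0 (1 - e^-1 * l1norm (x - x0)).
pose B' := Num.max B (l1norm x0 + e).
have B'0 : 0 <= B' by rewrite le_max B0.
have ie : 0 < e^-1 by rewrite invr_gt0.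
have Tl : lipc (@l1norm R n) B' 1 T.
  split.
  - move=> x; rewrite gt_max => /andP[_ h]; apply/max_idPl; rewrite subr_le0.
    rewrite ler_pdivlMl// mulr1.
    by have := l1normD (x - x0) x0; rewrite subrK; lra.
  - by move=> x; rewrite /T le_max lexx/= ge_max ler01/= gerBl mulr_ge0 ?l1norm_ge0// ltW.
  - exists e^-1; first exact: ltW.
    move=> x y; apply: le_trans (max0_onem_lip _ _) _.
    rewrite -mulrBr normrM (gtr0_norm ie) ler_pM2l// ler_norml; apply/andP; split.
      by have := l1normD (y - x) (x - x0); rewrite addrA subrK -(opprB x y) l1normN; lra.
    by have := l1normD (x - y) (y - x0); rewrite addrA subrK; lra.
have T0 : 0 < T x0 by rewrite /T subrr l1norm0 mulr0 subr0 lt_max ltr01 orbT.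
have TK x : T x <= \1_K x.
  rewrite indicE; case: (boolP (x \in K)) => [_|/negP xK].
    by rewrite /T ge_max ler01/= gerBl mulr_ge0 ?l1norm_ge0// ltW.
  rewrite /T ge_max lexx/= subr_le0 ler_pdivlMl// mulr1 leNgt; apply/negP => h.
  apply: xK; rewrite inE; apply: eK; rewrite -ball_normE/=.
  by apply: le_lt_trans (mxnorm_le_l1norm _) _; rewrite -opprB l1normN.
apply: (@lt_le_trans _ _ (iterint T)%:E); first by rewrite lte_fin; exact: iterint_gt0 B'0 Tl T0.
apply: (cvge_to_ge (cvg_lvol B0 gl gK)); apply: nearW => k; rewrite lee_fin.
apply: (le_iterint B'0 Tl (C' := 1)) => [|x]; last exact: le_trans (TK x) (Kg k x).
by apply: lipc_widen (gl k); rewrite le_max lexx.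
Qed.

Lemma dotvE n (x y : 'rV[R]_n) : dotv x y = (x *m y^T) 0 0.
Proof. by rewrite mxE; apply: eq_bigr => i _; rewrite mxE. Qed.

Lemma lvol0 n : lvol (set0 : set 'rV[R]_n) = 0%E.
Proof.
elim: n => [|n IH] /=; first by rewrite indicE in_set0.
by apply: integral0_eq => t _.
Qed.

Lemma continuous_dotv n (u : 'rV[R]_n) : continuous (fun x => dotv x u).
Proof.
suff h (l : seq 'I_n) : continuous (fun y : 'rV[R]_n => \sum_(i <- l) y 0 i * u 0 i).
  exact: h.
elim: l => [|i l IH] x.
  rewrite (_ : (fun y : 'rV[R]_n => _) = fun=> (0 : R)); last first.
    by apply/funext => y; rewrite big_nil.
  exact: cst_continuous.
rewrite (_ : (fun y : 'rV[R]_n => _) =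
    fun y => y 0 i * u 0 i + \sum_(j <- l) y 0 j * u 0 j); last first.
  by apply/funext => y; rewrite big_cons.
apply: (@continuousD _ _ _ (fun y : 'rV[R]_n => y 0 i * u 0 i)); last exact: IH.
by apply: continuousM; [exact: coord_continuous|exact: cst_continuous].
Qed.

(** * Orthonormal coordinates adapted to [u] *)

Section frame.
Variables (n : nat) (u : 'rV[R]_n.+1) (Q : 'M[R]_(n, n.+1)).
Hypothesis uu : dotv u u = 1.
Hypothesis QQ : Q *m Q^T = 1%:M.
Hypothesis Qu : Q *m u^T = 0.

(** In these coordinates the sections orthogonal to [u] are exactly the slices over which [lvol] is
    iterated. *)
Definition frame_mx : 'M[R]_n.+1 := col_mx u Q.

Let uuT : u *m u^T = 1%:M.
Proof.
by apply/matrixP => i j; rewrite !ord1 -dotvE uu mxE eqxx.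
Qed.

Lemma frame_orth : frame_mx *m frame_mx^T = 1%:M.
Proof.
rewrite /frame_mx (@tr_col_mx _ 1 n n.+1) (@mul_col_row _ 1 n n.+1 1 n).
have uQ : u *m Q^T = 0 by rewrite -[LHS]trmxK trmx_mul trmxK Qu trmx0.
by rewrite uuT QQ Qu uQ -(@scalar_mx_block _ 1 n).
Qed.

Lemma vcons_frame t (y : 'rV[R]_n) : vcons t y *m frame_mx = t *: u + y *m Q.
Proof.
rewrite /vcons /frame_mx (@mul_row_col _ 1 1 n n.+1); congr (_ + _).
by apply/rowP => j; rewrite !mxE big_ord1 mxE.
Qed.

Lemma dotv_vcons_frame t (y : 'rV[R]_n) : dotv (vcons t y *m frame_mx) u = t.
Proof.
rewrite vcons_frame dotvE mulmxDl -scalemxAl uuT -mulmxA Qu mulmx0 addr0.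
by rewrite !mxE eqxx mulr1.
Qed.

Lemma section_volE (K : set 'rV[R]_n.+1) t :
  section_vol K u Q t = fine (lvol [set y | K (vcons t y *m frame_mx)]).
Proof. by rewrite /section_vol; under eq_set do rewrite -vcons_frame. Qed.

End frame.
End slicing.

Theorem theorem1p1 (R : realType) (n : nat) (r p : R)
    (u : 'rV[R]_n.+1) (Q : 'M[R]_(n, n.+1)) (K : set 'rV[R]_n.+1) :
  0 <= r -> 0 < p ->
  dotv u u = 1 ->
  Q *m Q^T = 1%:M -> Q *m u^T = 0 ->
  compact K -> interior K !=set0 ->
  p_concave p (section_vol K u Q) ->
  powered_centroid r (section_vol K u Q) = 0 ->
  let ratio := fine (lvol (K `&` [set x | dotv x u <= 0])) / fine (lvol K) in
  (1 <= r -> powR ((p + 1) / (2 * p + r)) ((p + 1) / p) <= ratio) /\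
  (r <= 1 -> powR ((p + r) / (2 * p + r)) ((p + 1) / p) <= ratio).
Proof.
move=> r0 p0 uu QQ Qu cK iK fconc cen ratio.
have orth := frame_orth uu QQ Qu.
set f := section_vol K u Q in fconc cen.
pose H : set 'rV[R]_n.+1 := K `&` [set x | dotv x u <= 0].
have cdot := @continuous_dotv R n.+1 u.
have cH : compact H.
  apply: compact_closedI => //.
  by apply: (@closed_comp _ _ (fun x => dotv x u) [set t | t <= 0]) => [x _|]; [exact: cdot|exact: closed_le].
have [B [g [B0 gK Kg]]] := compact_lip_approx cK.
have [B1 [g1 [B10 gH _]]] := compact_lip_approx cH.
have [B2 B20 gK'] := lip_approx_mulmx B0 orth gK.
have [B3 B30 gH'] := lip_approx_mulmx B10 orth gH.
(* [section_vol] goes through [fine], so finiteness of every slice is needed to recover the volume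
   itself. *)
have fE t : (f t)%:E = lvol [set y | K (vcons t y *m frame_mx u Q)].
  rewrite /f section_volE fineK//.
  exact: (lvol_fin_num B20 (lip_approx_section t gK')).
have f_ge0 t : 0 <= f t.
  rewrite -lee_fin fE.
  by have /andP[] := lvol_bound B20 (lip_approx_section t gK').
have f_le t : f t <= (2 * B2) ^+ n.
  rewrite -lee_fin fE.
  by have /andP[] := lvol_bound B20 (lip_approx_section t gK').
have f_supp t : B2 < `|t| -> f t = 0.
  move=> Bt; apply: EFin_inj; rewrite fE.
  rewrite (_ : [set y | _] = set0) ?lvol0//.
  apply/seteqP; split => // y /= Ky.
  by apply: (lip_approx_bound (x := vcons t y) gK') => //; rewrite l1norm_vcons ltr_wpDr// l1norm_ge0.
have mf : measurable_fun setT f.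
  apply/measurable_EFinP; rewrite (_ : EFin \o f = fun t => lvol [set y | K (vcons t y *m frame_mx u Q)]).
    exact: (measurable_lvol_section B20 gK').
  by apply/funext => t /=; exact: fE.
have vK : fine (lvol K) = \int[@lebesgue_measure R]_t f t.
  rewrite -(lvol_mulmx B0 orth gK) /=; congr fine.
  by apply: eq_integral => t _; rewrite fE.
have vH : fine (lvol H) = \int[@lebesgue_measure R]_(t in `]-oo, 0]) f t.
  rewrite -(lvol_mulmx B10 orth gH) Rintegral_mkcond; congr fine.
  apply: eq_integral => t _; rewrite patchE.
  (* The half-space constrains only the slicing variable: a slice of [H] is the whole slice of [K]
     or empty. *)
  have HE y : H (vcons t y *m frame_mx u Q) = (K (vcons t y *m frame_mx u Q) /\ t <= 0).
    by rewrite /H/= dotv_vcons_frame.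
  case: ifPn => [|/negP] h.
    rewrite fE; congr lvol; apply/seteqP; split => y /=; rewrite HE; first by case.
    by split => //; move: h; rewrite inE/= in_itv.
  transitivity (lvol (set0 : set 'rV[R]_n)); last by rewrite lvol0.
  apply: (congr1 (@lvol R n)).
  apply/seteqP; split => // y /=.
  by rewrite HE => -[_ t0]; apply: h; rewrite inE/= in_itv.
have If0 : 0 < \int[@lebesgue_measure R]_t f t.
  rewrite -vK fine_gt0// (lvol_gt0 B0 gK Kg iK)/=.
  by have /andP[_ h] := lvol_bound B0 gK; rewrite (le_lt_trans h)// ltry.
rewrite /ratio -/H vK vH.
exact: (p_concave_grunbaum r0 p0 fconc mf f_le f_supp If0 cen).
Qed.
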